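(* Let $m\ge2$ and $0\le q\le m-1$ be integers, let $\mu:=(2^{(q)},1^{(2m-2q)},0^{(q)})$, let $I\subset J$ be nonempty subsets of $\{0,\dots,m\}$, each satisfying $1\in I\implies0\in I$ and $m-1\in I\implies m\in I$ (and likewise for $J$), and let $w\in W_{J,D_m}\backslash\widetilde W_{D_m}/W_{I,D_m}$. Then $w$ is $\mu$-permissible if and only if $w\equiv t_\mu\bmod W_{\mathrm{aff},D_m}$ and, for one, hence any, representative $\tilde w$ of $w$ in $\widetilde W_{D_m}/W_{I,D_m}$, the vector $\nu_k^{\tilde w}:=\tilde wa_k-a_k$ satisfies (SP1$'$) and (SP2$'$) for all $k\in I$, and (SP3$'$) for all $k\in I\cap\{0,1,m-1,m\}$, where: (SP1$'$) $\nu_k^{\tilde w}+(\nu_k^{\tilde w})^*=\mathbf2$ and $\mathbf0\le\nu_k^{\tilde w}\le\mathbf2$; (SP2$'$) $\#\{j:\nu_k^{\tilde w}(j)=2\}+\frac14\#\{j:\nu_k^{\tilde w}(j)\notin\mathbb Z\}\le q$; (SP3$'$) if $\nu_k^{\tilde w}\in\mathbb Z^{2m}$ and $\nu_k^{\tilde w}\not\equiv\mu\bmod Q^\vee_{D_m}$, then there exist $j_1\in A_k$ and $j_2\in B_k$ with $\nu_k^{\tilde w}(j_1)=\nu_k^{\tilde w}(j_2)=1$.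
   Context: Notation. For $v\in\mathbb R^{n}$, $v(j)$ is the $j$th entry, $v^*(j)=v(n+1-j)$, $\mathbf d=(d,\dots,d)$, $v\ge w$ means entrywise, and $(d^{(i)},e^{(j)},\dots)$ denotes $d$ repeated $i$ times, then $e$ repeated $j$ times, etc. $i^*:=2m+1-i$ for $i\in\{1,\dots,2m\}$. Root datum of split $GO_{2m}$. $X_*:=\{x\in\mathbb Z^{2m}: x_1+x_{2m}=\dots=x_m+x_{m+1}\}$; $Q^\vee_{D_m}:=\{x\in X_*: x_i+x_{i^*}=0\ \forall i,\ x_1+\dots+x_m\text{ even}\}$; $S_{2m}^\circ$ is the group of even permutations $\sigma\in S_{2m}$ with $\sigma(i^* )=\sigma(i)^*$ for all $i$. $\widetilde W_{D_m}:=X_*\rtimes S_{2m}^\circ$ acts on $\mathcal A:=X_*\otimes\mathbb R\subset\mathbb R^{2m}$ by affine transformations, $X_*$ by translations ($t_\lambda$) and $S_{2m}^\circ$ by permuting coordinates; $W_{\mathrm{aff},D_m}:=Q^\vee_{D_m}\rtimes S_{2m}^\circ$. The affine root hyperplanes $\{x_i-x_j=d\}$ ($j\ne i,i^*$, $d\in\mathbb Z$) determine facets in $\mathcal A$. The base alcove is $A_{D_m}:=\{x\in\mathcal A: x_1,\,x_{2m}-1<x_2<\dots<x_{m-1}<x_m,\,x_{m+1}\}$ (for $m=2$: $x_1,x_4-1<x_2,x_3$). $a_k:=((-\frac12)^{(k)},0^{(2m-2k)},(\frac12)^{(k)})$ for $0\le k\le m$, $a_{0'}:=(-1,0^{(2m-2)},1)$,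 $a_{m'}:=((-\frac12)^{(m-1)},\frac12,-\frac12,(\frac12)^{(m-1)})$. The minimal facets of $A_{D_m}$ are the lines $a+\mathbb R(1,\dots,1)$ for $a$ one of $a_0,a_{0'},a_2,a_3,\dots,a_{m-2},a_m,a_{m'}$. $A_k:=\{1,\dots,k\}\cup\{2m+1-k,\dots,2m\}$; $B_k:=\{k+1,\dots,2m-k\}$. $W_{I,D_m}:=\{w\in W_{\mathrm{aff},D_m}: wa_k=a_k\ \forall k\in I\}$; this is the stabilizer in $W_{\mathrm{aff},D_m}$ of the subfacet $F_I$ of $A_{D_m}$ whose minimal subfacets are the lines through $a_k$ for $k\in I\smallsetminus\{1,m-1\}$, together with the line through $a_{0'}$ if $1\in I$ and the line through $a_{m'}$ if $m-1\in I$. A double coset $w\in W_{J,D_m}\backslash\widetilde W_{D_m}/W_{I,D_m}$ is $\mu$-permissible if $w\equiv t_\mu\bmod W_{\mathrm{aff},D_m}$ and, for one, hence any, representative $\tilde w$, $\tilde wv-v\in\mathrm{Conv}(S_{2m}^\circ\mu)$ for all $v\in F_I$, where $\mathrm{Conv}(S_{2m}^\circ\mu)$ is the convex hull in $\mathcal A$ of the Weyl orbit of $\mu$. *)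

(* Defs.v *)
(* MathComp / MathComp-Analysis. Entries are indexed by 'I_(2 * m), i.e. from
   0: the entry of index i here is the one written x_{i+1} in the 1-based
   notation, and i^* = 2m + 1 - i becomes rev_ord i. *)
From HB Require Import structures.
From mathcomp Require Import all_boot all_order all_fingroup all_algebra.
From mathcomp Require Import all_classical all_reals all_analysis.

Set Implicit Arguments.
Unset Strict Implicit.
Unset Printing Implicit Defensive.

Import Order.TTheory GRing.Theory Num.Theory.
Import numFieldNormedType.Exports.

Local Open Scope classical_set_scope.
Local Open Scope ring_scope.

Section VectorOperations.
Variables (T : Type) (m : nat).

Definition vrev (v : 'rV[T]_(2 * m)) : 'rV[T]_(2 * m) :=
  \row_j v ord0 (rev_ord j).

(* The left action (s x)_i = x_{s^-1 i}, i.e. s sends e_i to e_{s i}. *)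
Definition vperm (s : 'S_(2 * m)) (v : 'rV[T]_(2 * m)) : 'rV[T]_(2 * m) :=
  col_perm s^-1%g v.

End VectorOperations.

Section RootDatum.
Variable m : nat.

Definition Xlow : set 'rV[int]_(2 * m) :=
  [set x | forall i j : 'I_(2 * m),
     x ord0 i + x ord0 (rev_ord i) = x ord0 j + x ord0 (rev_ord j)].

Definition Qvee : set 'rV[int]_(2 * m) :=
  [set x | [/\ Xlow x,
               forall i : 'I_(2 * m), x ord0 i + x ord0 (rev_ord i) = 0
             & (2 %| \sum_(i < 2 * m | (i < m)%N) x ord0 i)%Z]].

Definition Scirc : set 'S_(2 * m) :=
  [set s | ~~ odd_perm s /\
           forall i : 'I_(2 * m), s (rev_ord i) = rev_ord (s i)].

(* The pair (l, s) stands for t_l s in Z^{2m} >< S_{2m}. In MathComp the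
   product s' * s of permutations is the composite "first s', then s", whence
   the reversed order in wmul. *)
Definition affelt := ('rV[int]_(2 * m) * 'S_(2 * m))%type.

Definition wmul (w w' : affelt) : affelt :=
  (w.1 + vperm w.2 w'.1, (w'.2 * w.2)%g).

Definition wtrans (l : 'rV[int]_(2 * m)) : affelt := (l, 1%g).

Definition Wtilde : set affelt := [set w | Xlow w.1 /\ Scirc w.2].

Definition Waff : set affelt := [set w | Qvee w.1 /\ Scirc w.2].

Definition Waff_coset (w : affelt) : set affelt :=
  [set wmul w u | u in Waff].

Definition double_coset (H K : set affelt) (w : affelt) : set affelt :=
  [set wmul (wmul x w) y | x in H & y in K].

Definition is_double_coset (H K D : set affelt) : Prop :=
  exists2 w, Wtilde w & D = double_coset H K w.

Definition mu_vec (q : nat) : 'rV[int]_(2 * m) :=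
  \row_(j < 2 * m)
    (if (j < q)%N then 2 else if (j < 2 * m - q)%N then 1 else 0).

Definition Aset (k : nat) : {set 'I_(2 * m)} :=
  [set j : 'I_(2 * m) | (j < k)%N || (2 * m - k <= j)%N]%SET.

Definition Bset (k : nat) : {set 'I_(2 * m)} :=
  [set j : 'I_(2 * m) | (k <= j < 2 * m - k)%N]%SET.

(* 1 \in I implies 0 \in I, and m - 1 \in I implies m \in I. *)
Definition index_cond (I : {set 'I_m.+1}) : Prop :=
  forall k : 'I_m.+1, k \in I ->
    (k = 1%N :> nat -> ord0 \in I) /\ (k = (m - 1)%N :> nat -> ord_max \in I).

End RootDatum.

Section Apartment.
Variables (R : realType) (m : nat).
Local Notation V := 'rV[R]_(2 * m).

Definition toR (x : 'rV[int]_(2 * m)) : V := map_mx intr x.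

Definition waction (w : affelt m) (v : V) : V := toR w.1 + vperm w.2 v.

Definition apartment : set V :=
  [set x | forall i j : 'I_(2 * m),
     x ord0 i + x ord0 (rev_ord i) = x ord0 j + x ord0 (rev_ord j)].

(* x and y are on the same side of (or both on) every affine root
   hyperplane. *)
Definition same_facet (x y : V) : Prop :=
  forall (i j : 'I_(2 * m)) (d : int), j != i -> j != rev_ord i ->
    Num.sg (x ord0 i - x ord0 j - d%:~R) = Num.sg (y ord0 i - y ord0 j - d%:~R).

Definition is_facet (F : set V) : Prop :=
  exists2 x, apartment x & F = [set y | apartment y /\ same_facet x y].

Definition subfacet (G F : set V) : Prop := is_facet G /\ G `<=` closure F.

Definition minimal_subfacet (G F : set V) : Prop :=
  subfacet G F /\ forall G', subfacet G' G -> G' = G.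

(* With 1-based indices: x_1 and x_{2m} - 1 are < x_j for 2 <= j <= m + 1, and
   x_i < x_j for 2 <= i <= m - 1 and i < j <= m + 1. This is the chain
   x_1, x_{2m} - 1 < x_2 < ... < x_{m-1} < x_m, x_{m+1}, including for m = 2,
   where the part x_2 < ... < x_{m-1} is empty. *)
Definition base_alcove : set V :=
  [set x | [/\ apartment x,
    forall i j : 'I_(2 * m), i = 0%N :> nat -> (1 <= j <= m)%N ->
      x ord0 i < x ord0 j /\ x ord0 (rev_ord i) - 1 < x ord0 j
  & forall i j : 'I_(2 * m), (1 <= i)%N -> (i < m - 1)%N -> (i < j <= m)%N ->
      x ord0 i < x ord0 j]].

Definition avec (k : nat) : V :=
  \row_(j < 2 * m)
    (if (j < k)%N then - 2^-1 else if (j < 2 * m - k)%N then 0 else 2^-1).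

Definition avec0' : V :=
  \row_(j < 2 * m)
    (if j == 0%N :> nat then -1 else if j == (2 * m - 1)%N :> nat then 1 else 0).

Definition avecm' : V :=
  \row_(j < 2 * m)
    (if (j < m - 1)%N then - 2^-1
     else if j == (m - 1)%N :> nat then 2^-1
     else if j == m :> nat then - 2^-1
     else 2^-1).

Definition line (a : V) : set V := [set a + const_mx t | t in [set: R]].

Definition FI_vertices (I : {set 'I_m.+1}) : set V :=
  [set a | exists2 k : 'I_m.+1, k \in I &
     [\/ [/\ k <> 1%N :> nat, k <> (m - 1)%N :> nat & a = avec k],
         k = 1%N :> nat /\ a = avec0'
       | k = (m - 1)%N :> nat /\ a = avecm']].

(* The points of the subfacet F_I of the base alcove, which is the one whose
   minimal subfacets are exactly the lines through the points of
   FI_vertices I. *)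
Definition FI (I : {set 'I_m.+1}) : set V :=
  [set v | exists F : set V,
     [/\ subfacet F base_alcove,
         [set G | minimal_subfacet G F] = line @` FI_vertices I
       & F v]].

Definition WI (I : {set 'I_m.+1}) : set (affelt m) :=
  [set w | Waff w /\
           forall k : 'I_m.+1, k \in I -> waction w (avec k) = avec k].

Definition conv_hull (S : set V) : set V :=
  smallest (fun C : set V => convex_set C) S.

Definition conv_orbit (mu : 'rV[int]_(2 * m)) : set V :=
  conv_hull [set toR (vperm s mu) | s in @Scirc m].

(* The condition w = t_mu mod W_aff for a double coset D of subgroups of
   W_aff: D is sent to the class of t_mu in W~ / W_aff. *)
Definition dcoset_congr (mu : 'rV[int]_(2 * m)) (D : set (affelt m)) : Prop :=
  D `<=` Waff_coset (wtrans mu).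

Definition permissible (mu : 'rV[int]_(2 * m)) (I : {set 'I_m.+1})
    (D : set (affelt m)) : Prop :=
  dcoset_congr mu D /\
  exists2 w, D w & forall v, FI I v -> conv_orbit mu (waction w v - v).

Definition nu (k : nat) (w : affelt m) : V := waction w (avec k) - avec k.

Definition integral_vec (v : V) : Prop :=
  forall j, v ord0 j \is a Num.int.

Definition congr_Qvee (v : V) (mu : 'rV[int]_(2 * m)) : Prop :=
  exists2 x, Qvee x & v - toR mu = toR x.

Definition SP1' (v : V) : Prop :=
  v + vrev v = const_mx 2 /\ forall j, 0 <= v ord0 j <= 2.

Definition SP2' (q : nat) (v : V) : Prop :=
  #|[set j | v ord0 j == 2]%SET|%:R
    + 4^-1 * #|[set j | v ord0 j \isn't a Num.int]%SET|%:R <= q%:R :> R.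

Definition SP3' (q k : nat) (v : V) : Prop :=
  integral_vec v -> ~ congr_Qvee v (mu_vec m q) ->
  exists j1 j2 : 'I_(2 * m),
    [/\ j1 \in Aset m k, j2 \in Bset m k, v ord0 j1 = 1 & v ord0 j2 = 1].

Definition spin_conditions (q : nat) (I : {set 'I_m.+1}) (w : affelt m) : Prop :=
  (forall k : 'I_m.+1, k \in I -> SP1' (nu k w) /\ SP2' q (nu k w)) /\
  (forall k : 'I_m.+1, k \in I ->
     (k : nat) \in [:: 0; 1; m - 1; m]%N -> SP3' q k (nu k w)).

End Apartment.

(* Main.v *)
(** Idea. Put dev v = sum_j |v_j - 1|. The hull of the orbit of mu lies in the
    polytope v + v^* = 2, 0 <= v <= 2, dev v <= 2q, and contains all
    half-integral points of that polytope; for half-integral v these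
    inequalities are (SP1') and (SP2'). As v |-> w v - v is affine and invariant
    under v |-> v + (t, ..., t), permissibility can be tested at the vertices:
    the a_k with k <> 1, m - 1, and a_0' (if 1 is in I) and a_m' (if m - 1 is in
    I). It remains to compare the displacement of a_0' = 2 a_1 - a_0 with those
    of a_0 and a_1, and likewise at the other end. If the linear part s of w
    moves the pair {1, 1^*} off itself, (SP2') at a_1 together with
    w = t_mu mod W_aff (a parity condition) gives the bound at a_0'. If s
    exchanges 1 and 1^*, the displacement of a_1 is integral and not congruent
    to mu, and the bound at a_0' amounts to its entries at 1 and 1^* being
    equal to 1, which is (SP3'). For k = 0 and k = m, (SP3') is vacuous. *)
Require Import Defs.
From HB Require Import structures.
From mathcomp Require Import all_boot all_order all_fingroup all_algebra.
From mathcomp Require Import all_classical all_reals all_analysis.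
From mathcomp Require Import ring lra zify.
Import Order.TTheory GRing.Theory Num.Theory.
Import numFieldNormedType.Exports.
Set Implicit Arguments.
Unset Strict Implicit.
Unset Printing Implicit Defensive.
Local Open Scope classical_set_scope.
Local Open Scope ring_scope.

(** The two directions reach the vertices differently. F_I is relatively open and its vertices lie
    only in its closure, so permissibility is carried to them by a limit taken in the polytope;
    conversely, membership in the hull spreads from the vertices over F_I by convexity. As F_I is
    given only through its minimal subfacets, those of an arbitrary point of the closed alcove must
    be determined; the relation [incident], which compares where roots take the extreme values 0 and
    -1, turns this into linear arithmetic.

    The polytope is invariant under all signed permutations, the orbit of mu a priori only under the
    even ones. The gap closes because q < m: mu has an entry 1, which the sign change x -> 2 - x
    fixes.

    The parity condition has force because [dev] can change only by multiples of 4 when an integral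
    v with v + v^* = 2 moves by an element of Q^vee, whereas the step from a_0 to a_1 and that from
    a_1 to a_0' each cost at most 2.

    Since W_J fixes F_I pointwise, another representative only changes displacements by a Weyl group
    element; this settles the choice between one and any. *)

Lemma low_rev m (j : 'I_(2 * m)) : (rev_ord j < m)%N = ~~ (j < m)%N.
Proof. by have := ltn_ord j; rewrite /=; lia. Qed.

Lemma rev_neq m (j : 'I_(2 * m)) : rev_ord j != j.
Proof. by apply/eqP => /(congr1 val) /=; have := ltn_ord j; lia. Qed.

(** * Parity of signed permutations *)

Section SignedPermutations.
Variable m : nat.
Implicit Types (s t : 'S_(2 * m)) (i j x : 'I_(2 * m)).

Definition commutes_rev s := forall i, s (rev_ord i) = rev_ord (s i).

Lemma commutes_revM s t :
  commutes_rev s -> commutes_rev t -> commutes_rev (s * t)%g.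
Proof. by move=> hs ht i; rewrite !permM hs ht. Qed.

Lemma commutes_revV s : commutes_rev s -> commutes_rev s^-1%g.
Proof. by move=> hs i; apply: (@perm_inj _ s); rewrite hs !permKV. Qed.

(** With i^* read as -i these are reflections of the signed permutation group. [flip i] is a single
    sign change, an odd permutation of the 2m indices; for j other than i and i^*, [swap i j] is
    even and so belongs to [Scirc]. *)
Definition flip i : 'S_(2 * m) := tperm i (rev_ord i).
Definition swap i j : 'S_(2 * m) :=
  (tperm i j * tperm (rev_ord i) (rev_ord j))%g.

Lemma rev_eq i j : (rev_ord i == rev_ord j) = (i == j).
Proof. by rewrite (inj_eq rev_ord_inj). Qed.

Lemma rev_eqL i j : (rev_ord i == j) = (i == rev_ord j).
Proof. by rewrite -{1}(rev_ordK j) rev_eq. Qed.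

Lemma flip_rev i : commutes_rev (flip i).
Proof.
move=> x; rewrite /flip !permE /= !rev_eq rev_eqL.
have [->|xi] := eqVneq x i; last first.
  by case: ifP.
by rewrite eq_sym (negPf (rev_neq i)) rev_ordK.
Qed.

Lemma swapE i j x : j != i -> j != rev_ord i ->
  swap i j x = if x == i then j else if x == j then i
    else if x == rev_ord i then rev_ord j
    else if x == rev_ord j then rev_ord i else x.
Proof.
move=> ji jri; rewrite /swap permM !permE /=.
have ijr : (i == rev_ord j) = false by rewrite -rev_eqL eq_sym; apply/negbTE.
have [_|xi] := eqVneq x i.
  by rewrite (negPf jri) eq_sym (negPf (rev_neq j)).
have [_|xj] := eqVneq x j.
  by rewrite ijr eq_sym (negPf (rev_neq i)).
by [].
Qed.

Lemma swap_rev i j : j != i -> j != rev_ord i -> commutes_rev (swap i j).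
Proof.
move=> ji jri x; rewrite !swapE //.
have ir : (i == rev_ord i) = false by rewrite eq_sym (negPf (rev_neq i)).
have jr : (j == rev_ord j) = false by rewrite eq_sym (negPf (rev_neq j)).
have ijr : (i == rev_ord j) = false by rewrite -rev_eqL eq_sym (negPf jri).
have ij : (i == j) = false by rewrite eq_sym (negPf ji).
rewrite !rev_eq !rev_eqL.
have [->|xi] := eqVneq x i; first by rewrite ir ijr.
have [->|xj] := eqVneq x j; first by rewrite (negPf jri) jr.
have [_|xri] := eqVneq x (rev_ord i); first by rewrite rev_ordK.
by have [_|xrj] := eqVneq x (rev_ord j); rewrite ?rev_ordK.
Qed.

Lemma odd_flip i : odd_perm (flip i).
Proof. by rewrite odd_tperm eq_sym rev_neq. Qed.

Lemma odd_swap i j : j != i -> odd_perm (swap i j) = false.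
Proof. by move=> ji; rewrite odd_permM !odd_tperm rev_eq eq_sym ji. Qed.

(** The number of sign changes of a signed permutation, the indices below m carrying one sign and
    their conjugates the other. *)
Definition nflips s : nat := \sum_(x < 2 * m) ((x < m)%N && ~~ (s x < m)%N).

Lemma big4 i j (F : 'I_(2 * m) -> nat) : j != i -> j != rev_ord i ->
  (\sum_x F x = F i + F (rev_ord i) + (F j + F (rev_ord j))
    + \sum_(x | [&& x != i, x != rev_ord i, x != j & x != rev_ord j]) F x)%N.
Proof.
move=> ji jri.
rewrite (bigD1 i) //= (bigD1 (rev_ord i)) ?rev_neq //=.
rewrite (bigD1 j) ?ji ?jri //= (bigD1 (rev_ord j)) /=; last first.
  by rewrite rev_neq rev_eq ji rev_eqL jri.
rewrite !addnA; congr addn; apply: eq_bigl => x.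
by rewrite -!andbA.
Qed.

Lemma big2 i (F : 'I_(2 * m) -> nat) :
  (\sum_x F x = F i + F (rev_ord i)
    + \sum_(x | (x != i) && (x != rev_ord i)) F x)%N.
Proof. by rewrite (bigD1 i) //= (bigD1 (rev_ord i)) ?rev_neq //= addnA. Qed.

(** Composing with one reflection makes s fix a further index i, so the number of moved indices
    drops. A [flip] changes both parities, a [swap] neither. *)
Lemma odd_perm_rev s : commutes_rev s -> odd_perm s = odd (nflips s).
Proof.
have [n] := ubnP #|[set x | s x != x]%SET|; elim: n s => // n IHn s.
rewrite ltnS => hn hs.
have [i si|s1] := pickP (fun i => s i != i); last first.
  have -> : s = 1%g by apply/permP => x; rewrite perm1; apply/eqP/negbFE/s1.
  rewrite odd_perm1 /nflips big1 // => x _; rewrite perm1.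
  by case: (x < m)%N.
set j := s i.
have [jri|jri] := eqVneq j (rev_ord i).
  pose s' := (s * flip i)%g.
  have hs' : commutes_rev s' by apply: commutes_revM => //; exact: flip_rev.
  have s'i : s' i = i by rewrite permM -/j jri tpermR.
  have s'ri : s' (rev_ord i) = rev_ord i by rewrite hs' s'i.
  have s'E x : x != i -> x != rev_ord i -> s' x = s x.
    move=> xi xri; rewrite permM tpermD //.
      by apply/eqP => h; move: xri; rewrite -(inj_eq (@perm_inj _ s)) hs -/j jri rev_ordK -h eqxx.
    by apply/eqP => h; move: xi; rewrite -(inj_eq (@perm_inj _ s)) -/j jri -h eqxx.
  have /IHn/(_ hs') : (#|[set x | s' x != x]%SET| < n)%N.
    apply: leq_trans hn; apply: proper_card; apply/properP; split.
      apply/fintype.subsetP => x; rewrite !inE; have [->|xi] := eqVneq x i; first by rewrite si.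
      have [->|xri] := eqVneq x (rev_ord i); first by rewrite s'ri eqxx.
      by rewrite s'E.
    by exists i; rewrite !inE ?s'i ?eqxx.
  rewrite odd_permM odd_flip addbT /nflips (big2 i) s'i s'ri.
  rewrite (big2 i (fun x : 'I_(2 * m) => (x < m)%N && ~~ (s x < m)%N : nat)).
  rewrite hs -/j jri rev_ordK !low_rev.
  under eq_bigr => x /andP[xi xri] do rewrite s'E //.
  set S := \sum_(x | _) _; move/(congr1 negb); rewrite negbK => ->.
  by case: (i < m)%N => /=; rewrite ?addn0 ?add0n ?add1n ?oddS.
have ji : j != i by [].
pose t := swap j i.
have ij : i != j by rewrite eq_sym.
have irj : i != rev_ord j by rewrite eq_sym rev_eqL.
pose s' := (s * t)%g.
have hs' : commutes_rev s' by apply: commutes_revM => //; exact: swap_rev.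
(* Besides i, only the preimage l of i and the conjugates of both get a new image: [s'] fixes i and
   sends l to j, which removes i from its cycle. *)
pose l := (s^-1)%g i.
have sl : s l = i by rewrite permKV.
have s'i : s' i = i by rewrite permM -/j swapE // eqxx.
have s'l : s' l = j by rewrite permM sl swapE // (negPf ij) eqxx.
have li : l != i by apply/eqP => h; move: ji; rewrite /j -{1}h sl eqxx.
have lri : l != rev_ord i.
  by apply/eqP => h; move: irj; rewrite -{1}sl h hs -/j eqxx.
have s'E x : [&& x != i, x != rev_ord i, x != l & x != rev_ord l] -> s' x = s x.
  have sI y z : (y == z) = (s y == s z) by rewrite (inj_eq perm_inj).
  rewrite (sI x i) (sI x l) (sI x (rev_ord i)) (sI x (rev_ord l)) !hs sl -/j.
  case/and4P=> h1 h2 h3 h4.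
  by rewrite permM swapE // (negPf h1) (negPf h2) (negPf h3) (negPf h4).
have /IHn/(_ hs') : (#|[set x | s' x != x]%SET| < n)%N.
  apply: leq_trans hn; apply: proper_card; apply/properP; split.
    apply/fintype.subsetP => x; rewrite !inE; have [->|xi] := eqVneq x i; first by rewrite si.
    have [->|xri] := eqVneq x (rev_ord i); first by rewrite hs' s'i eqxx.
    have [->|xl] := eqVneq x l; first by rewrite sl (eq_sym i) li.
    have [->|xrl] := eqVneq x (rev_ord l); first by rewrite hs sl rev_eq (eq_sym i) li.
    by rewrite s'E // xi xri xl xrl.
  by exists i; rewrite !inE ?s'i ?eqxx.
rewrite odd_permM odd_swap // addbF => ->; rewrite /nflips !(big4 _ li lri).
rewrite !hs' !hs s'i s'l sl -/j !low_rev.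
under eq_bigr => x hx do rewrite s'E //.
rewrite !oddD !oddb; congr addb.
by case: (i < m)%N; case: (l < m)%N; case: (j < m)%N.
Qed.

End SignedPermutations.

(** * Convex predicates and convex combinations *)

Section Convexity.
Variables (R : realType) (M : lmodType R).

Definition convex_pred (P : M -> Prop) := forall x y (t : R),
  0 <= t <= 1 -> P x -> P y -> P (t *: x + (1 - t) *: y).

Lemma convex_setP (A : set (convex_lmodType M)) :
  convex_set A <-> convex_pred (A : M -> Prop).
Proof.
split=> [cA x y t /andP[t0 t1] Ax Ay|cA x y t]; last first.
  by rewrite !inE => Ax Ay; apply: cA; rewrite ?ge0 ?le1.
have /(_ (Itv01 t0 t1)) := cA x y.
by rewrite !inE => /(_ Ax Ay).
Qed.

Lemma convex_mid (P : M -> Prop) (x y : M) : convex_pred P -> P x -> P y ->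
  P (2^-1 *: (x + y)).
Proof.
move=> cP Px Py; have := cP x y 2^-1 _ Px Py.
have -> : 1 - 2^-1 = 2^-1 :> R by lra.
by rewrite -scalerDr; apply; lra.
Qed.

(** Dividing by the total weight makes the claim stable under dropping a term, so that induction on
    the list works. P is asked only at points of positive weight, since only those are known to be
    incident in [closed_alcove_ind]. *)
Lemma convex_sum (I : eqType) (r : seq I) (P : M -> Prop) (t : I -> R)
    (p : I -> M) : convex_pred P ->
  (forall i, 0 <= t i) -> (forall i, 0 < t i -> P (p i)) ->
  0 < \sum_(i <- r) t i ->
  P ((\sum_(i <- r) t i)^-1 *: \sum_(i <- r) t i *: p i).
Proof.
move=> cP t0 tP; elim: r => [|i r IHr]; first by rewrite big_nil ltxx.
rewrite !big_cons; set S := \sum_(i <- r) t i; set X := \sum_(i <- r) t i *: p i.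
have S0 : 0 <= S by apply: sumr_ge0.
move=> iS.
have [Se|Sn] := eqVneq S 0.
  have -> : X = 0.
    rewrite /X big_seq big1 // => j jr.
    have -> : t j = 0; last by rewrite scale0r.
    apply/eqP; move/eqP: Se; rewrite psumr_eq0 // => /allP/(_ _ jr).
    by [].
  move: iS; rewrite Se !addr0 => iS.
  by rewrite scalerA mulVf ?gt_eqF // scale1r; exact: tP.
have SP : 0 < S by rewrite lt_neqAle eq_sym Sn.
have [ti|ti] := eqVneq (t i) 0.
  by rewrite ti scale0r !add0r; exact: IHr.
have tiP : 0 < t i by rewrite lt_neqAle eq_sym ti t0.
have h : 0 <= t i / (t i + S) <= 1.
  by rewrite divr_ge0 ?(ltW iS) //= ler_pdivrMr // mul1r lerDl.
have := cP (p i) (S^-1 *: X) _ h (tP _ tiP) (IHr SP).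
rewrite scalerDr !scalerA.
have -> : (1 - t i / (t i + S)) / S = (t i + S)^-1.
  by field; rewrite Sn gt_eqF.
by rewrite mulrC.
Qed.

End Convexity.

Lemma vpermE (T : Type) m (s : 'S_(2 * m)) (v : 'rV[T]_(2 * m)) j :
  vperm s v ord0 j = v ord0 ((s^-1)%g j).
Proof. by rewrite /vperm mxE. Qed.

(** * The convex hull of the Weyl orbit *)

Section Polytope.
Variables (R : realType) (m : nat).
Local Notation V := 'rV[R]_(2 * m).
Implicit Types (u v : V) (s : 'S_(2 * m)) (i j p : 'I_(2 * m)) (q : nat).

Lemma vpermM s s' v : vperm s (vperm s' v) = vperm (s' * s)%g v.
Proof. by apply/rowP => j; rewrite !vpermE invMg permM. Qed.

Lemma vpermK s v : vperm s^-1%g (vperm s v) = v.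
Proof. by apply/rowP => j; rewrite !vpermE invgK permK. Qed.

(** Moving along e_p - e_{p^*} preserves v + v^* and changes a single conjugate pair of entries, so
    the effect on [dev] is that of one entry, doubled. *)
Definition dvec p : V := delta_mx ord0 p - delta_mx ord0 (rev_ord p).

Lemma dvecE p j : dvec p ord0 j = (j == p)%:R - (j == rev_ord p)%:R.
Proof. by rewrite !mxE eqxx. Qed.

Lemma dvec_id p : dvec p ord0 p = 1.
Proof. by rewrite dvecE eqxx eq_sym (negPf (rev_neq p)) subr0. Qed.

Lemma dvec_rev p j : dvec p ord0 (rev_ord j) = - dvec p ord0 j.
Proof. by rewrite !dvecE rev_eqL rev_eq opprB. Qed.

Lemma dvec_other p j : j != p -> j != rev_ord p -> dvec p ord0 j = 0.
Proof. by move=> jp jrp; rewrite dvecE (negPf jp) (negPf jrp) subrr. Qed.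

Lemma vperm_dvec s p : commutes_rev s -> vperm s (dvec p) = dvec (s p).
Proof.
move=> hs; apply/rowP => j; rewrite vpermE !dvecE -hs.
by rewrite -!(inj_eq (@perm_inj _ s) ((s^-1)%g j)) permKV.
Qed.

Lemma dvec_revp p : dvec (rev_ord p) = - dvec p.
Proof. by rewrite /dvec rev_ordK opprB. Qed.

Lemma addZE (v u : V) (t : R) j : (v + t *: u) ord0 j = v ord0 j + t * u ord0 j.
Proof. by rewrite mxE [X in _ + X]mxE. Qed.

Definition sym2 v := forall j, v ord0 j + v ord0 (rev_ord j) = 2.
Definition in02 v := forall j, 0 <= v ord0 j <= 2.
Definition dev v : R := \sum_j `|v ord0 j - 1|.
Definition polytope q v := [/\ sym2 v, in02 v & dev v <= (2 * q)%:R].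

Lemma sym2_dvec v p (t : R) : sym2 v -> sym2 (v + t *: dvec p).
Proof. by move=> hv j; rewrite !addZE dvec_rev; have := hv j; lra. Qed.

Lemma dev_dvec v p (t : R) : sym2 v ->
  dev (v + t *: dvec p) =
  dev v + 2 * (`|v ord0 p + t - 1| - `|v ord0 p - 1|).
Proof.
move=> hv; rewrite /dev.
have dE u : dev u = `|u ord0 p - 1| + (`|u ord0 (rev_ord p) - 1| +
    \sum_(j | (j != p) && (j != rev_ord p)) `|u ord0 j - 1|).
  by rewrite /dev (bigD1 p) //= (bigD1 (rev_ord p)) ?rev_neq.
rewrite -!/(dev _) !dE.
have -> : \sum_(j | (j != p) && (j != rev_ord p)) `|(v + t *: dvec p) ord0 j - 1|
   = \sum_(j | (j != p) && (j != rev_ord p)) `|v ord0 j - 1|.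
  apply: eq_bigr => j /andP[jp jrp].
  by rewrite addZE dvec_other // mulr0 addr0.
rewrite !addZE dvec_rev dvec_id.
have -> : v ord0 (rev_ord p) = 2 - v ord0 p by have := hv p; lra.
have -> : 2 - v ord0 p + t * -1 - 1 = - (v ord0 p + t - 1) by ring.
have -> : 2 - v ord0 p - 1 = - (v ord0 p - 1) by ring.
by rewrite !normrN mulr1; ring.
Qed.

Lemma dev_vperm s v : dev (vperm s v) = dev v.
Proof.
rewrite /dev (reindex_inj (@perm_inj _ s)) /=.
by apply: eq_bigr => j _; rewrite vpermE permK.
Qed.

Lemma polytope_vperm q s v : commutes_rev s -> polytope q v ->
  polytope q (vperm s v).
Proof.
move=> hs [h1 h2 h3]; split; last by rewrite dev_vperm.
  by move=> j; rewrite !vpermE (commutes_revV hs).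
by move=> j; rewrite vpermE.
Qed.

Lemma polytope_convex q : convex_pred (polytope q).
Proof.
move=> x y t /andP[t0 t1] [x1 x2 x3] [y1 y2 y3].
have E j : (t *: x + (1 - t) *: y) ord0 j =
    t * x ord0 j + (1 - t) * y ord0 j by rewrite !mxE.
split.
- by move=> j; rewrite !E; have := x1 j; have := y1 j => h1 h2; nra.
- move=> j; rewrite E; have /andP[a1 a2] := x2 j; have /andP[b1 b2] := y2 j.
  by apply/andP; split; nra.
- apply: (@le_trans _ _ (t * dev x + (1 - t) * dev y)); last by nra.
  rewrite /dev !mulr_sumr -big_split /=; apply: ler_sum => j _; rewrite E.
  have -> : t * x ord0 j + (1 - t) * y ord0 j - 1 =
    t * (x ord0 j - 1) + (1 - t) * (y ord0 j - 1) by ring.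
  apply: le_trans (ler_normD _ _) _.
  by rewrite !normrM (ger0_norm t0) (@ger0_norm _ (1 - t)) ?subr_ge0.
Qed.

Lemma muE q j : toR R (mu_vec m q) ord0 j =
  if (j < q)%N then 2 else if (j < 2 * m - q)%N then 1 else 0.
Proof. by rewrite !mxE; case: ifP => // _; case: ifP. Qed.

Lemma sym2_mu q : (q <= m)%N -> sym2 (toR R (mu_vec m q)).
Proof.
move=> qm j; rewrite !muE /=; have := ltn_ord j.
case: (ltnP j q) => h1; case: (ltnP j (2 * m - q)) => h2;
  case: (ltnP (2 * m - j.+1) q) => h3;
  case: (ltnP (2 * m - j.+1) (2 * m - q)) => h4; try lia; lra.
Qed.

Lemma card_ord_lt n q : (q <= n)%N -> #|[set j : 'I_n | (j < q)%N]%SET| = q.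
Proof.
move=> qn; rewrite -sum1dep_card -(big_ord_widen_cond n predT (fun=> 1%N)) //.
by rewrite sum1_card card_ord.
Qed.

Definition ints v := forall j, [\/ v ord0 j = 0, v ord0 j = 1 | v ord0 j = 2].


Lemma card2_rev v (c : R) : sym2 v ->
  #|[set j | v ord0 j == c]%SET| = #|[set j | v ord0 j == 2 - c]%SET|.
Proof.
move=> hv; rewrite -(card_imset _ (@rev_ord_inj (2 * m))); apply: eq_card => j.
rewrite !inE; apply/imsetP/eqP => [[i]|h].
  by rewrite inE => /eqP hi ->; have := hv i; lra.
by exists (rev_ord j); rewrite ?rev_ordK // inE; apply/eqP; have := hv j; lra.
Qed.

End Polytope.

(** * Half-integers between 0 and 2 *)

Section HalfIntegers.
Variable R : realType.

Lemma int_num2 : (2 : R) \is a Num.int.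
Proof. exact: natr_int. Qed.

Lemma half_nint (n : int) : (n%:~R + 2^-1 : R) \isn't a Num.int.
Proof.
apply/negP => /intrP[k hk].
have : (2 * n + 1)%:~R = (2 * k)%:~R :> R by rewrite intrD !intrM -hk; field.
by move/intr_inj; lia.
Qed.

Lemma half_cases (x : R) : x * 2 \is a Num.int -> 0 <= x <= 2 ->
  [|| x == 0, x == 1, x == 2, x == 2^-1 | x == 3 / 2].
Proof.
move=> /intrP[n hn] /andP[x0 x2].
have n0 : (0 <= n)%R by rewrite -(@ler0z R) -hn; lra.
have n4 : (n <= 4)%R by rewrite -(@ler_int R) -hn /=; lra.
have {}hn : x = n%:~R / 2 by lra.
case: n n0 n4 hn => // -[|[|[|[|[|n]]]]] //= _ _ ->; apply/or4P.
- by apply: Or41; rewrite mul0r.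
- by apply: Or44; rewrite mul1r eqxx.
- by apply: Or42; apply/eqP; field.
- by apply: Or44; rewrite eqxx orbT.
- by apply: Or43; apply/eqP; lra.
Qed.

Lemma half_nint_cases (x : R) : x * 2 \is a Num.int -> 0 <= x <= 2 ->
  x \isn't a Num.int -> x = 2^-1 \/ x = 3 / 2.
Proof.
move=> xh x02; have := half_cases xh x02.
case/or4P => [/eqP->|/eqP->|/eqP->|/orP[]/eqP->]; first by rewrite int_num0.
- by rewrite int_num1.
- by rewrite int_num2.
- by left.
- by right.
Qed.

Lemma int_cases (x : R) : x \is a Num.int -> 0 <= x <= 2 ->
  [\/ x = 0, x = 1 | x = 2].
Proof.
move=> xi x02.
have : x * 2 \is a Num.int by rewrite rpredM // int_num2.
have h1 := half_nint 0; have h2 := half_nint 1.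
move/half_cases => /(_ x02); case/or4P => [/eqP h|/eqP h|/eqP h|/orP[]/eqP h].
- exact: Or31.
- exact: Or32.
- exact: Or33.
- by move: h1; rewrite add0r -h xi.
- move: h2; rewrite (_ : 1%:~R + 2^-1 = x) ?xi // h /=; lra.
Qed.

End HalfIntegers.

Section ConvexHullOfOrbit.
Variables (R : realType) (m : nat).
Local Notation V := 'rV[R]_(2 * m).
Implicit Types (u v : V) (s : 'S_(2 * m)) (i j p : 'I_(2 * m)) (q : nat).

Definition halfint v := forall j, v ord0 j * 2 \is a Num.int.
Definition ntwos v := #|[set j | v ord0 j == 2]%SET|.
Definition nint v := #|[set j | v ord0 j \isn't a Num.int]%SET|.

(** An entry 0 or 2 contributes 1 to [dev], an entry 1/2 or 3/2 contributes 1/2, and v + v^* = 2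
    makes the zeros as many as the twos. Half of this is the left-hand side of (SP2'), which
    explains the weight 1/4 there. *)
Lemma dev_half v : sym2 v -> in02 v -> halfint v ->
  dev v = 2 * (ntwos v)%:R + 2^-1 * (nint v)%:R.
Proof.
move=> hs h02 hh; pose c (x : R) := #|[set j | v ord0 j == x]%SET|.
have cE (P : pred 'I_(2 * m)) :
    #|[set j | P j]%SET|%:R = \sum_j (P j)%:R :> R.
  by rewrite -sum1dep_card natr_sum big_mkcond; apply: eq_bigr => j _; case: (P j).
have -> : 2 * (ntwos v)%:R = (c 2)%:R + (c 0)%:R :> R.
  by rewrite /c (card2_rev 0 hs) subr0 -/(ntwos v); ring.
rewrite /nint /c !cE mulr_sumr -!big_split /=; apply: eq_bigr => j _.
have h1 := half_nint R 0; have h2 := half_nint R 1.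
have := half_cases (hh j) (h02 j).
case/or4P => [/eqP h|/eqP h|/eqP h|/orP[]/eqP h]; rewrite h.
- have -> : (0 == 2 :> R) = false by apply/eqP; lra.
  by rewrite eqxx int_num0 /= sub0r normrN1; ring.
- have -> : (1 == 2 :> R) = false by apply/eqP; lra.
  have -> : (1 == 0 :> R) = false by apply/eqP; lra.
  by rewrite int_num1 /= subrr normr0; ring.
- have -> : (2 == 0 :> R) = false by apply/eqP; lra.
  rewrite eqxx int_num2 /=.
  have -> : 2 - 1 = 1 :> R by ring.
  by rewrite normr1; ring.
- have -> : (2^-1 == 2 :> R) = false by apply/eqP; lra.
  have -> : (2^-1 == 0 :> R) = false by apply/eqP; lra.
  rewrite add0r in h1; rewrite h1 /=.
  by rewrite ltr0_norm; lra.
- have -> : (3 / 2 == 2 :> R) = false by apply/eqP; lra.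
  have -> : (3 / 2 == 0 :> R) = false by apply/eqP; lra.
  have -> : (3 / 2 : R) \isn't a Num.int.
    by move: h2; rewrite (_ : 1%:~R + 2^-1 = 3 / 2 :> R) // mulr1z; lra.
  by rewrite gtr0_norm /=; lra.
Qed.

Lemma SP12P q v : halfint v ->
  (SP1' v /\ SP2' q v) <-> polytope q v.
Proof.
move=> hh; have symE : v + vrev v = const_mx 2 <-> sym2 v.
  split=> [h j|h]; last by apply/rowP => j; have := h j; rewrite !mxE.
  by have := congr1 (fun x : V => x ord0 j) h; rewrite !mxE.
rewrite /SP1' /SP2' symE; split.
  move=> [[hs h02]]; have := dev_half hs h02 hh; rewrite /nint /ntwos => E h.
  by split=> //; rewrite E natrM; lra.
move=> [hs h02]; rewrite (dev_half hs h02 hh) /nint /ntwos natrM => h.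
by split=> //; lra.
Qed.

Lemma integral_ints v q : in02 v -> integral_vec v -> ints v.
Proof. by move=> h02 hi j; exact: int_cases. Qed.

Lemma ints_int v : ints v -> integral_vec v.
Proof.
by move=> h j; case: (h j) => ->; rewrite ?int_num0 ?int_num1 ?int_num2.
Qed.

Lemma integral_half v : integral_vec v -> halfint v.
Proof. by move=> h j; rewrite rpredM // int_num2. Qed.

Lemma ints_in02 v : ints v -> in02 v.
Proof. by move=> h j; case: (h j) => ->; lra. Qed.

Lemma dev_ints v : sym2 v -> ints v ->
  dev v = (2 * ntwos v)%:R.
Proof.
move=> hs hi; rewrite dev_half //; last 2 first.
- exact: ints_in02.
- exact: integral_half (ints_int hi).
have -> : nint v = 0%N.
  by apply: eq_card0 => j; rewrite !inE (ints_int hi).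
by rewrite mulr0 addr0 natrM.
Qed.

Lemma ints_mu q : ints (toR R (mu_vec m q)).
Proof.
move=> j; rewrite muE; case: ifP => _; first exact: Or33.
by case: ifP => _; [exact: Or32|exact: Or31].
Qed.

Lemma dev_mu q : (q <= m)%N -> dev (toR R (mu_vec m q)) = (2 * q)%:R.
Proof.
move=> qm; rewrite dev_ints; [|exact: sym2_mu|exact: ints_mu].
have -> // : ntwos (toR R (mu_vec m q)) = q.
rewrite -[RHS](@card_ord_lt (2 * m)); last by lia.
apply: eq_card => j; rewrite !inE muE.
case: ifP; rewrite ?eqxx // => _; case: ifP => _; apply/eqP; lra.
Qed.

Lemma polytope_mu q : (q <= m)%N -> polytope q (toR R (mu_vec m q)).
Proof.
move=> qm; split; [exact: sym2_mu|exact/ints_in02/ints_mu|].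
by rewrite dev_mu.
Qed.

Lemma toR_vperm s (x : 'rV[int]_(2 * m)) : toR R (vperm s x) = vperm s (toR R x).
Proof. by apply/rowP => j; rewrite !mxE. Qed.

Lemma conv_orbit_convex (mu : 'rV[int]_(2 * m)) : convex_pred (conv_orbit mu : V -> Prop).
Proof.
move=> x y t h hx hy A hA; have [/= cA sA] := hA.
by apply: (iffLR (convex_setP A) cA) => //; [exact: hx|exact: hy].
Qed.

Lemma conv_orbit_polytope q : (q <= m)%N ->
  conv_orbit (mu_vec m q) `<=` (polytope q : set V).
Proof.
move=> qm; apply: smallest_sub.
  by apply/convex_setP; exact: polytope_convex.
move=> _ [s [_ hs] <-]; rewrite toR_vperm.
by apply: polytope_vperm => //; exact: polytope_mu.
Qed.

Lemma ScircM s s' : Scirc s -> Scirc s' -> Scirc (s * s')%g.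
Proof.
move=> [os cs] [os' cs']; split; last exact: commutes_revM.
by rewrite odd_permM (negPf os) (negPf os').
Qed.

Lemma ScircV s : Scirc s -> Scirc s^-1%g.
Proof. by move=> [os cs]; split; [rewrite odd_permV|exact: commutes_revV]. Qed.

(** The preimage of the hull under [vperm s] is convex and contains the orbit, hence contains the
    hull. *)
Lemma conv_orbit_vperm (mu : 'rV[int]_(2 * m)) s v : Scirc s ->
  conv_orbit mu v -> conv_orbit mu (vperm s v).
Proof.
move=> hs; move: v; apply: smallest_sub.
  apply/convex_setP => x y t t01 hx hy /=.
  have -> : vperm s (t *: x + (1 - t) *: y) =
      t *: vperm s x + (1 - t) *: vperm s y.
    by apply/rowP => j; rewrite !mxE.
  exact: conv_orbit_convex.
move=> _ [s' hs' <-] /=; apply: sub_gen_smallest.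
exists (s' * s)%g; first exact: ScircM.
by rewrite toR_vperm -vpermM -toR_vperm.
Qed.

Lemma conv_orbit_vpermV (mu : 'rV[int]_(2 * m)) s v : Scirc s ->
  conv_orbit mu (vperm s v) -> conv_orbit mu v.
Proof. by move=> hs /(conv_orbit_vperm (ScircV hs)); rewrite vpermK. Qed.

Lemma conv_orbit_mu (mu : 'rV[int]_(2 * m)) : conv_orbit mu (toR R mu).
Proof.
apply: sub_gen_smallest; exists 1%g.
  by split; [rewrite odd_perm1|move=> i; rewrite !perm1].
by congr toR; apply/rowP => j; rewrite vpermE invg1 perm1.
Qed.

End ConvexHullOfOrbit.

(** * Half-integral points of the polytope lie in the hull *)

Section PolytopeInHull.
Variables (R : realType) (m q : nat).
Hypothesis qm : (q < m)%N.
Local Notation V := 'rV[R]_(2 * m).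
Local Notation mu := (mu_vec m q).
Local Notation muR := (toR R mu).
Implicit Types (u v : V) (s : 'S_(2 * m)) (i j p : 'I_(2 * m)).

Let qlem : (q <= m)%N := ltnW qm.

(** Makes v a rearrangement of mu: when [dev] is 2q, each of 0, 1, 2 occurs as often as in mu. *)
Lemma card_ints v : sym2 v -> ints v -> dev v = (2 * q)%:R ->
  [/\ #|[set j | v ord0 j == 2]%SET| = q,
      #|[set j | v ord0 j == 0]%SET| = q
    & #|[set j | v ord0 j == 1]%SET| = (2 * m - 2 * q)%N].
Proof.
move=> hs hi; rewrite dev_ints // /ntwos => /eqP; rewrite eqr_nat => /eqP hd.
have h2 : #|[set j | v ord0 j == 2]%SET| = q by lia.
have h0 : #|[set j | v ord0 j == 0]%SET| = q by rewrite card2_rev // subr0.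
split=> //.
have := cardsC [set j | v ord0 j == 1]%SET; rewrite card_ord.
suff -> : (~: [set j | v ord0 j == 1] =
    [set j | v ord0 j == 2] :|: [set j | v ord0 j == 0])%SET.
  rewrite cardsU h2 h0 (_ : _ :&: _ = finset.set0)%SET ?cards0; first by lia.
  apply/setP => j; rewrite !inE; apply/negbTE/negP => /andP[/eqP-> /eqP]; lra.
apply/setP => j; rewrite !inE; case: (hi j) => ->; rewrite ?eqxx ?orbT ?orTb.
- by apply/eqP; lra.
- by apply/esym/negbTE/norP; split; apply/eqP; lra.
- by apply/eqP; lra.
Qed.

Lemma conv_orbit_perm s v v' : Scirc s ->
  (forall x, v' ord0 x = v ord0 (s x)) ->
  conv_orbit mu v' -> conv_orbit mu v.
Proof.
move=> hs hv' hK; apply: (conv_orbit_vpermV (ScircV hs)).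
suff -> : vperm s^-1%g v = v' by [].
by apply/rowP => x; rewrite vpermE invgK hv'.
Qed.

(* The hull is stable under even signed permutations; a sign change is made
   even by composing it with a sign change at an entry 1, which exists since
   q < m. *)
Lemma conv_orbit_ints0 v : sym2 v -> ints v -> dev v = (2 * q)%:R ->
  conv_orbit mu v.
Proof.
have [n] := ubnP #|[set j | v ord0 j != muR ord0 j]%SET|.
elim: n v => // n IHn v; rewrite ltnS => hn hs hi hd.
have [v2 v0 v1] := card_ints hs hi hd.
have sm := sym2_mu R qlem.
have [m2 m0 m1] := card_ints sm (@ints_mu R m q) (dev_mu R qlem).
have [i hvi|hv] := pickP (fun j => v ord0 j != muR ord0 j); last first.
  suff -> : v = muR by exact: conv_orbit_mu.
  by apply/rowP => j; apply/eqP/negbFE/hv.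
(* The value of mu at i is taken equally often by v and by mu, and v misses it at i; so v takes it
   at some j where mu does not. *)
have [j vj mj] : exists2 j, v ord0 j = muR ord0 i & muR ord0 j != muR ord0 i.
  set c := muR ord0 i.
  have hc : #|[set j | v ord0 j == c]%SET| = #|[set j | muR ord0 j == c]%SET|.
    by rewrite /c; case: (@ints_mu R m q i) => ->; rewrite ?v0 ?v1 ?v2 ?m0 ?m1 ?m2.
  have [j /andP[/eqP h1 h2]|h] := pickP (fun j => (v ord0 j == c) && (muR ord0 j != c)).
    by exists j.
  have /eqP hE : ([set j | v ord0 j == c] == [set j | muR ord0 j == c])%SET.
    rewrite eqEcard hc leqnn andbT; apply/fintype.subsetP => j.
    by rewrite !inE => hj; have := h j; rewrite hj /= => /negbFE.
  by move/setP/(_ i): hE; rewrite !inE (negPf hvi) eqxx.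
have ji : j != i by apply/eqP => h; move: mj; rewrite h eqxx.
have symV k : v ord0 (rev_ord k) = 2 - v ord0 k by have := hs k; lra.
have symM k : muR ord0 (rev_ord k) = 2 - muR ord0 k by have := sm k; lra.
(* An element of [Scirc] that brings the right entry to i and spoils no entry already right lowers
   the number of disagreements with mu. *)
have reduce s : Scirc s ->
    (forall x, v ord0 (s x) != muR ord0 x -> v ord0 x != muR ord0 x) ->
    v ord0 (s i) = muR ord0 i -> conv_orbit mu v.
  move=> sS hsx hsi.
  have hv' x : vperm s^-1%g v ord0 x = v ord0 (s x) by rewrite vpermE invgK.
  apply: (conv_orbit_perm sS hv'); apply: IHn.
  - apply: leq_trans hn; apply: proper_card; apply/properP; split.
      by apply/fintype.subsetP => x; rewrite !inE hv'; exact: hsx.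
    by exists i; rewrite !inE ?hv' ?hsi ?eqxx.
  - by move=> x; rewrite !hv' (proj2 sS).
  - by move=> x; rewrite hv'.
  - by rewrite dev_vperm.
have [jri|jri] := eqVneq j (rev_ord i); last first.
  apply: (reduce (swap i j)); last by rewrite swapE // eqxx.
    by split; [rewrite odd_swap|exact: swap_rev].
  move=> x; rewrite swapE //.
  case: (eqVneq x i) => [->|xi]; first by rewrite vj eqxx.
  case: (eqVneq x j) => [->|xj]; first by rewrite vj (eq_sym (muR ord0 i)) mj.
  case: (eqVneq x (rev_ord i)) => [->|xri].
    by rewrite !symV symM vj eqxx.
  case: (eqVneq x (rev_ord j)) => [->|//].
  by rewrite !symV !symM vj => _; apply: contra mj => /eqP h; apply/eqP; lra.
have vi : v ord0 i = 2 - muR ord0 i by rewrite -vj jri symV; lra.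
have [l vl] : exists l : 'I_(2 * m), v ord0 l = 1.
  have : #|[set j | v ord0 j == 1]%SET| != 0%N by rewrite v1; lia.
  by rewrite -lt0n => /card_gt0P[l]; rewrite inE => /eqP ?; exists l.
have mi1 : muR ord0 i != 1.
  by apply/eqP => h; move: hvi; rewrite vi h; case/eqP; lra.
have li : l != i by apply/eqP => h; move: mi1; rewrite h in vl; case/eqP; lra.
have lri : l != rev_ord i.
  by apply/eqP => h; move: mi1; rewrite h symV in vl; case/eqP; lra.
have il : i != l by rewrite eq_sym.
have irl : i != rev_ord l by rewrite eq_sym rev_eqL.
have tE (a b : 'I_(2 * m)) : a != b -> a != rev_ord b -> flip b a = a.
  by move=> h1 h2; rewrite tpermD // eq_sym.
apply: (reduce (flip i * flip l)%g).
- split; first by rewrite odd_permM !odd_flip.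
  by apply: commutes_revM; exact: flip_rev.
- move=> x; rewrite permM.
  case: (eqVneq x i) => [->|xi].
    by rewrite tpermL tE ?rev_eq ?rev_eqL // symV vi => /eqP; case; lra.
  case: (eqVneq x (rev_ord i)) => [->|xri].
    by rewrite tpermR tE // symV symM vi => h; apply: contra h => /eqP h; apply/eqP; lra.
  rewrite (tE x) //; case: (eqVneq x l) => [->|xl].
    by rewrite tpermL symV vl => h; apply: contra h => /eqP h; apply/eqP; lra.
  case: (eqVneq x (rev_ord l)) => [->|xrl].
    by rewrite tpermR symV vl => h; apply: contra h => /eqP h; apply/eqP; lra.
  by rewrite tE.
- by rewrite permM tpermL tE ?rev_eq ?rev_eqL // -jri.
Qed.

Lemma conv_orbit_mid v u : conv_orbit mu (v + u) -> conv_orbit mu (v - u) ->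
  conv_orbit mu v.
Proof.
move=> h1 h2; have := convex_mid (conv_orbit_convex (mu := mu)) h1 h2.
suff -> : 2^-1 *: (v + u + (v - u)) = v by [].
by apply/rowP => j; rewrite !mxE; lra.
Qed.

(** With fewer than q twos, v is the midpoint of the two integral points obtained by turning a
    conjugate pair of entries 1, 1 into 2, 0 and into 0, 2. Both have one more two, whence the
    induction on q minus the number of twos. *)
Lemma conv_orbit_ints v : sym2 v -> ints v -> dev v <= (2 * q)%:R ->
  conv_orbit mu v.
Proof.
have [n] := ubnP (q - ntwos v)%N.
elim: n v => // n IHn v; rewrite ltnS => hn hs hi hd.
have hdE := dev_ints hs hi.
have h2 : (ntwos v <= q)%N.
  by move: hd; rewrite hdE ler_nat; lia.
have [he|hne] := eqVneq (ntwos v) q.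
  by apply: conv_orbit_ints0; rewrite // hdE he.
(* Without an entry 1 there would be m twos, more than q. *)
have [i vi|h1] := pickP (fun j => v ord0 j == 1); last first.
  have := cardsC [set j | v ord0 j == 2%R]%SET; rewrite card_ord -/(ntwos v).
  suff -> : (~: [set j | v ord0 j == 2%R] = [set j | v ord0 j == 0%R])%SET.
    by rewrite (card2_rev 0 hs) subr0 -/(ntwos v) => hc; exfalso; lia.
  apply/setP => j; rewrite !inE; have := h1 j; case: (hi j) => ->.
  - by rewrite eqxx => _; apply/eqP; lra.
  - by rewrite eqxx.
  - by rewrite eqxx => _; apply/esym/negbTE/eqP; lra.
move/eqP in vi.
have step t : t = 1 \/ t = -1 -> conv_orbit mu (v + t *: dvec R i).
  move=> t1; have hs' := sym2_dvec i t hs.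
  have hi' : ints (v + t *: dvec R i).
    move=> j; rewrite addZE.
    have [->|ji] := eqVneq j i.
      rewrite dvec_id vi mulr1; case: t1 => ->; [apply: Or33|apply: Or31]; lra.
    have [->|jri] := eqVneq j (rev_ord i).
      rewrite dvec_rev dvec_id; have := hs i; rewrite vi => hvi.
      by case: t1 => ->; [apply: Or31|apply: Or33]; lra.
    by rewrite dvec_other // mulr0 addr0.
  have hd' : dev (v + t *: dvec R i) = dev v + 2.
    rewrite dev_dvec // vi subrr normr0.
    have -> : 1 + t - 1 = t by ring.
    by case: t1 => ->; rewrite ?normrN normr1; ring.
  have : (2 * ntwos (v + t *: dvec R i) =
      2 * ntwos v + 2)%N.
    by apply/eqP; rewrite -(eqr_nat R) -dev_ints // hd' hdE natrD.
  move=> hc; apply: IHn => //; first by lia.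
  by rewrite hd' hdE -natrD ler_nat; lia.
apply: (@conv_orbit_mid _ (dvec R i)).
  by rewrite -(scale1r (dvec R i)); apply: step; left.
by rewrite -(scaleN1r (dvec R i)); apply: step; right.
Qed.

Lemma half_int_dvec v p (t : R) : halfint v -> t * 2 \is a Num.int ->
  halfint (v + t *: dvec R p).
Proof.
move=> hv ht j; rewrite addZE mulrDl rpredD // mulrAC rpredM // dvecE.
by rewrite rpredB // natr_int.
Qed.

Lemma nint_rev v j : sym2 v ->
  (v ord0 (rev_ord j) \is a Num.int) = (v ord0 j \is a Num.int).
Proof.
move=> hv; have -> : v ord0 (rev_ord j) = 2 - v ord0 j by have := hv j; lra.
by rewrite rpredBl // int_num2.
Qed.

(* The entries 3/2 are rounded up and down, in pairs or, for the last one,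
   alone; in the latter case the slack in the bound on dev is used. *)
Lemma polytope_conv_orbit v : halfint v -> polytope q v -> conv_orbit mu v.
Proof.
have [n] := ubnP (nint v); elim: n v => // n IHn v; rewrite ltnS.
move=> hn hh [hs h02 hd].
have [i hvi|hv] := pickP (fun j => v ord0 j \isn't a Num.int); last first.
  have hv' : integral_vec v by move=> j; apply/negbFE/hv.
  by apply: conv_orbit_ints => //; exact: integral_ints.
wlog vi : i hvi / v ord0 i = 3 / 2.
  move=> W; have [h|h] := half_nint_cases (hh i) (h02 i) hvi; last exact: (W i).
  apply: (W (rev_ord i)); first by rewrite nint_rev.
  by have := hs i; lra.
have half1 : (2^-1 : R) * 2 \is a Num.int.
  by rewrite mulVf ?int_num1 // pnatr_eq0.
(* With 3/2 at both i and j, moving the two entries by 1/2 in opposite directions leaves [dev]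
   unchanged, as both stay at least 1. *)
have [j0|hother] := pickP
    (fun j => [&& j != i, j != rev_ord i & v ord0 j \isn't a Num.int]).
  move=> jP; have {jP} [j [ji jri vj]] :
      exists j, [/\ j != i, j != rev_ord i & v ord0 j = 3 / 2].
    have /and3P[ji jri hvj] := jP.
    have [h|h] := half_nint_cases (hh j0) (h02 j0) hvj; last by exists j0.
    exists (rev_ord j0); rewrite rev_eqL jri rev_eq ji; split=> //.
    by have := hs j0; lra.
  have dij : dvec R i ord0 j = 0 by rewrite dvec_other.
  have dji : dvec R j ord0 i = 0.
    by apply: dvec_other; rewrite eq_sym // rev_eqL.
  have step t : t = 2^-1 \/ t = - 2^-1 ->
      conv_orbit mu (v + t *: dvec R i + (- t) *: dvec R j).
    move=> t1; have ht : t * 2 \is a Num.int.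
      by case: t1 => ->; rewrite ?mulNr ?rpredN.
    have hs1 := sym2_dvec i t hs; have hs2 := sym2_dvec j (- t) hs1.
    have E k : (v + t *: dvec R i + (- t) *: dvec R j) ord0 k =
        v ord0 k + t * dvec R i ord0 k - t * dvec R j ord0 k.
      by rewrite !addZE mulNr.
    have Ei : (v + t *: dvec R i + - t *: dvec R j) ord0 i = 3 / 2 + t.
      by rewrite E dji dvec_id vi; ring.
    have Ej : (v + t *: dvec R i + - t *: dvec R j) ord0 j = 3 / 2 - t.
      by rewrite E dij dvec_id vj; ring.
    have Eo k : k != i -> k != rev_ord i -> k != j -> k != rev_ord j ->
        (v + t *: dvec R i + - t *: dvec R j) ord0 k = v ord0 k.
      by move=> *; rewrite E !dvec_other //; ring.
    have inti : (3 / 2 + t \is a Num.int) && (3 / 2 - t \is a Num.int).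
      case: t1 => ->.
        rewrite (_ : 3 / 2 + 2^-1 = 2 :> R); last by lra.
        by rewrite (_ : 3 / 2 - 2^-1 = 1 :> R) ?int_num2 ?int_num1 //; lra.
      rewrite (_ : 3 / 2 - 2^-1 = 1 :> R); last by lra.
      by rewrite (_ : 3 / 2 - - 2^-1 = 2 :> R) ?int_num2 ?int_num1 //; lra.
    have /andP[inti1 inti2] := inti.
    have revE k (h : sym2 (v + t *: dvec R i + - t *: dvec R j)) :
        (v + t *: dvec R i + - t *: dvec R j) ord0 (rev_ord k) =
        2 - (v + t *: dvec R i + - t *: dvec R j) ord0 k.
      by have := h k; lra.
    apply: IHn.
    - apply: leq_trans hn; apply: proper_card; apply/properP; split.
        apply/fintype.subsetP => k; rewrite !inE.
        have [->|ki] := eqVneq k i; first by rewrite Ei inti1.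
        have [->|kri] := eqVneq k (rev_ord i).
          by rewrite nint_rev // Ei inti1.
        have [->|kj] := eqVneq k j; first by rewrite Ej inti2.
        have [->|krj] := eqVneq k (rev_ord j).
          by rewrite nint_rev // Ej inti2.
        by rewrite Eo.
      by exists i; rewrite !inE ?Ei ?inti1.
    - by do 2!(apply: half_int_dvec; rewrite ?mulNr ?rpredN //).
    split=> //.
      move=> k; have [->|ki] := eqVneq k i; first by rewrite Ei; case: t1 => ->; lra.
      have [->|kri] := eqVneq k (rev_ord i).
        by rewrite revE // Ei; case: t1 => ->; lra.
      have [->|kj] := eqVneq k j; first by rewrite Ej; case: t1 => ->; lra.
      have [->|krj] := eqVneq k (rev_ord j).
        by rewrite revE // Ej; case: t1 => ->; lra.
      by rewrite Eo.
    suff -> : dev (v + t *: dvec R i + - t *: dvec R j) = dev v by [].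
    rewrite !dev_dvec // addZE dij vj vi mulr0 addr0.
    case: t1 => ->.
      rewrite !ger0_norm; lra.
    rewrite !ger0_norm; lra.
  apply: (@conv_orbit_mid _ (2^-1 *: dvec R i + - 2^-1 *: dvec R j)).
    by rewrite addrA; apply: step; left.
  rewrite opprD -!scaleNr addrA; apply: step; right.
  by [].
(* Only the pair i, i^* is non-integral, so [dev] is odd and stays below the even bound 2q; there is
   room for the increase by 1 when the entry is rounded up. *)
have devE : dev v = (2 * ntwos v + 1)%:R.
  rewrite dev_half // natrD natrM; congr (_ + _).
  have -> : nint v = 2%N.
    rewrite /nint (_ : [set j | _] = [set i; rev_ord i])%SET.
      by rewrite cards2 eq_sym rev_neq.
    apply/setP => j; rewrite !inE; have [->|ji] := eqVneq j i; first by rewrite hvi.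
    have [->|jri] := eqVneq j (rev_ord i); first by rewrite nint_rev.
    by have := hother j; rewrite ji jri.
  by rewrite mulVf // pnatr_eq0.
have step t : t = 2^-1 \/ t = - 2^-1 -> conv_orbit mu (v + t *: dvec R i).
  move=> t1; have ht : t * 2 \is a Num.int.
    by case: t1 => ->; rewrite ?mulNr ?rpredN.
  have hs1 := sym2_dvec i t hs.
  have Ei : (v + t *: dvec R i) ord0 i = 3 / 2 + t by rewrite addZE dvec_id vi mulr1.
  have Eri : (v + t *: dvec R i) ord0 (rev_ord i) = 2 - (3 / 2 + t).
    by have := hs1 i; rewrite Ei; lra.
  have Eo k : k != i -> k != rev_ord i -> (v + t *: dvec R i) ord0 k = v ord0 k.
    by move=> *; rewrite addZE dvec_other // mulr0 addr0.
  have inti : 3 / 2 + t \is a Num.int.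
    case: t1 => ->.
      by rewrite (_ : 3 / 2 + 2^-1 = 2 :> R) ?int_num2 //; lra.
    by rewrite (_ : 3 / 2 - 2^-1 = 1 :> R) ?int_num1 //; lra.
  apply: IHn.
  - apply: leq_trans hn; apply: proper_card; apply/properP; split.
      apply/fintype.subsetP => k; rewrite !inE.
      have [->|ki] := eqVneq k i; first by rewrite Ei inti.
      have [->|kri] := eqVneq k (rev_ord i).
        by rewrite nint_rev // Ei inti.
      by rewrite Eo.
    by exists i; rewrite !inE ?Ei ?inti.
  - exact: half_int_dvec.
  split=> //.
    move=> k; have [->|ki] := eqVneq k i; first by rewrite Ei; case: t1 => ->; lra.
    have [->|kri] := eqVneq k (rev_ord i); first by rewrite Eri; case: t1 => ->; lra.
    by rewrite Eo.
  rewrite dev_dvec // vi.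
  have : dev v + 1 <= (2 * q)%:R.
    move: hd; rewrite devE ler_nat -(natrD _ _ 1%N) ler_nat; lia.
  by case: t1 => -> h; rewrite !ger0_norm; lra.
apply: (@conv_orbit_mid _ (2^-1 *: dvec R i)); first by apply: step; left.
by rewrite -scaleNr; apply: step; right.
Qed.

End PolytopeInHull.

(** * Displacements of neighbouring vertices *)

Section Parity.
Variables (R : realType) (m q : nat).
Local Notation V := 'rV[R]_(2 * m).
Local Notation mu := (mu_vec m q).
Implicit Types (u v : V) (i j p : 'I_(2 * m)).

Lemma sum_low (F : 'I_(2 * m) -> R) :
  (forall j, F (rev_ord j) = F j) ->
  \sum_j F j = 2 * \sum_(j < 2 * m | (j < m)%N) F j.
Proof.
move=> hF; rewrite (bigID (fun j : 'I_(2 * m) => (j < m)%N)) /=.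
rewrite [X in _ + X](reindex_inj (@rev_ord_inj (2 * m))) /=.
have -> : \sum_(j < 2 * m | ~~ (2 * m - j.+1 < m)%N) F (rev_ord j)
    = \sum_(j < 2 * m | (j < m)%N) F j.
  apply: eq_big => [j|j _]; last exact: hF.
  by rewrite -[X in ~~ X]/(rev_ord j < m)%N low_rev negbK.
ring.
Qed.

Lemma int_norm_mod2 (z z' : int) :
  exists a : int, `|z| - `|z'| = z - z' + 2 * a.
Proof.
pose f (y : int) : int := if 0 <= y then 0 else - y.
have fE y : `|y| = y + 2 * f y.
  by rewrite /f; case: lerP => hy; [rewrite ger0_norm|rewrite ltr0_norm]; lia.
by exists (f z - f z'); rewrite !fE; ring.
Qed.

(** [dev] is twice the sum of |v_j - 1| over the lower half. As |z| and z have the same parity, and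
    the lower half of an element of Q^vee has even sum, that sum agrees modulo 2 with the one for
    mu, whose [dev] is 2q. *)
Lemma dev_mod4 v : (q <= m)%N -> sym2 v -> congr_Qvee v mu ->
  exists k : int, dev v = (2 * q)%:R + 4 * k%:~R.
Proof.
move=> qm hs [x [_ _ /dvdzP[k hk]] hx].
have vE j : v ord0 j - 1 = (mu ord0 j + x ord0 j - 1)%:~R.
  have := congr1 (fun y : V => y ord0 j) hx; rewrite !mxE => h.
  by rewrite !rmorphD /= -h rmorphN1; ring.
have mE j : toR R mu ord0 j - 1 = (mu ord0 j - 1)%:~R.
  by rewrite mxE rmorphB.
have norm_rev u : sym2 u -> forall j,
    `|u ord0 (rev_ord j) - 1| = `|u ord0 j - 1|.
  move=> hu j; rewrite -normrN; congr `|_|; have := hu j; lra.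
have [a ha] : exists a : int,
    \sum_(j < 2 * m | (j < m)%N) `|mu ord0 j + x ord0 j - 1| =
    \sum_(j < 2 * m | (j < m)%N) `|mu ord0 j - 1| + 2 * a.
  have /choice[f hf] : forall j : 'I_(2 * m), exists a : int,
      `|mu ord0 j + x ord0 j - 1| - `|mu ord0 j - 1| = x ord0 j + 2 * a.
    move=> j; have [a ha] :=
      int_norm_mod2 (mu ord0 j + x ord0 j - 1) (mu ord0 j - 1).
    by exists a; rewrite ha; ring.
  exists (k + \sum_(j < 2 * m | (j < m)%N) f j).
  rewrite mulrDr [2 * k]mulrC -hk mulr_sumr -!big_split /=.
  by apply: eq_bigr => j _; have := hf j; lia.
exists a; rewrite -(dev_mu R qm) /dev !sum_low; last 2 first.
- exact/norm_rev/sym2_mu.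
- exact: norm_rev.
have E (F : 'I_(2 * m) -> int) : \sum_(j < 2 * m | (j < m)%N) `|(F j)%:~R : R| =
    (\sum_(j < 2 * m | (j < m)%N) `|F j|)%:~R.
  by rewrite rmorph_sum; apply: eq_bigr => j _ /=; rewrite intr_norm.
under eq_bigr do rewrite vE.
under [in RHS]eq_bigr do rewrite mE.
rewrite !E ha rmorphD rmorphM /=; ring.
Qed.

(** The lower half of e_p - e_{p^*} has sum 1 or -1, which is odd. *)
Lemma dvec_not_congr v p : congr_Qvee v mu -> ~ congr_Qvee (v + dvec R p) mu.
Proof.
move=> [x [_ _ /dvdzP[k hk]] hx] [x' [_ _ /dvdzP[k' hk']] hx'].
have dE j : dvec R p ord0 j = (x' ord0 j - x ord0 j)%:~R.
  have := congr1 (fun y : V => y ord0 j) hx.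
  have := congr1 (fun y : V => y ord0 j) hx'.
  by rewrite rmorphB !mxE /= => <- <-; ring.
have : \sum_(j < 2 * m | (j < m)%N) dvec R p ord0 j = ((k' - k) * 2)%:~R.
  by rewrite mulrBl -hk -hk' -sumrB rmorph_sum; apply: eq_bigr => j _.
have -> : \sum_(j < 2 * m | (j < m)%N) dvec R p ord0 j =
    (if (p < m)%N then 1 else -1)%:~R.
  case: ifP => hp.
    rewrite (bigD1 p) //= dvec_id big1 ?addr0 // => j /andP[jm jp].
    rewrite dvec_other //; apply/eqP => h; move: jm; rewrite h.
    by rewrite -[X in is_true X]/(rev_ord p < m)%N low_rev hp.
  have hrp : (rev_ord p < m)%N by rewrite low_rev hp.
  rewrite (bigD1 (rev_ord p)) //= dvec_rev dvec_id big1 ?addr0 // => j /andP[jm jp].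
  by rewrite dvec_other //; apply/eqP => h; move: jm; rewrite h hp.
by move/intr_inj; case: ifP => _; lia.
Qed.

End Parity.

(** * Passing from the shift by 1/2 to the shift by 1 *)

Section Extension.
Variables (R : realType) (m q : nat).
Hypothesis qm : (q < m)%N.
Local Notation V := 'rV[R]_(2 * m).
Local Notation mu := (mu_vec m q).
Variables (v : V) (p i : 'I_(2 * m)).
Hypotheses (vint : integral_vec v) (vcongr : congr_Qvee v mu).
Hypothesis vP : polytope q v.

(* If v is the displacement of a point a under an element with linear part s
   and i = s p, this is the displacement of a - t (e_p - e_{p^*}); see
   displ_slide. *)
Definition slide (t : R) : V := v + t *: dvec R p + (- t) *: dvec R i.

Lemma slideE t j :
  slide t ord0 j = v ord0 j + t * dvec R p ord0 j - t * dvec R i ord0 j.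
Proof. by rewrite /slide !addZE mulNr. Qed.

Lemma slide_sym t : sym2 (slide t).
Proof. by apply/sym2_dvec/sym2_dvec; case: vP. Qed.

Section Far.
Hypotheses (ip : i != p) (irp : i != rev_ord p).

Lemma far_p : dvec R i ord0 p = 0.
Proof. by apply: dvec_other; rewrite eq_sym // rev_eqL. Qed.

Lemma far_i : dvec R p ord0 i = 0.
Proof. exact: dvec_other. Qed.

Lemma slide_p t : slide t ord0 p = v ord0 p + t.
Proof. by rewrite slideE far_p dvec_id mulr1 mulr0 subr0. Qed.

Lemma slide_i t : slide t ord0 i = v ord0 i - t.
Proof. by rewrite slideE far_i dvec_id mulr1 mulr0 addr0. Qed.

Lemma slide_dev t : dev (slide t) = dev v
  + 2 * (`|v ord0 p + t - 1| - `|v ord0 p - 1|)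
  + 2 * (`|v ord0 i - t - 1| - `|v ord0 i - 1|).
Proof.
have [hs _ _] := vP; rewrite /slide dev_dvec; last exact: sym2_dvec.
by rewrite dev_dvec // addZE far_i mulr0 addr0.
Qed.

(* If dev v <= 2q - 2 then dev v <= 2q - 4, by the congruence of v and mu; this
   makes up for the bound on slide 1 being weaker than that on slide 1/2. *)
Lemma far_polytope : polytope q (slide 2^-1) -> polytope q (slide 1).
Proof.
have [hs h02 hd] := vP => -[hs' h02' hd']; split; first exact: slide_sym.
  move=> j.
  have rE : slide 1 ord0 (rev_ord j) = 2 - slide 1 ord0 j.
    by have := slide_sym 1 j; lra.
  (* An integer in [0, 2] that can make a half step inside the interval can make the whole step. *)
  have hp : 0 <= slide 1 ord0 p <= 2.
    rewrite slide_p; have := h02' p; rewrite slide_p; have := h02 p.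
    by case: (int_cases (vint p) (h02 p)) => ->; lra.
  have hi : 0 <= slide 1 ord0 i <= 2.
    rewrite slide_i; have := h02' i; rewrite slide_i; have := h02 i.
    by case: (int_cases (vint i) (h02 i)) => ->; lra.
  have rE' k : slide 1 ord0 (rev_ord k) = 2 - slide 1 ord0 k.
    by have := slide_sym 1 k; lra.
  have [->//|jp] := eqVneq j p.
  have [->|jrp] := eqVneq j (rev_ord p); first by rewrite rE'; lra.
  have [->//|ji] := eqVneq j i.
  have [->|jri] := eqVneq j (rev_ord i); first by rewrite rE'; lra.
  by rewrite slideE !dvec_other // !mulr0 addr0 subr0.
have [k hk] := dev_mod4 (ltnW qm) hs vcongr.
move: hd'; rewrite !slide_dev.
have := h02' p; rewrite slide_p; have := h02' i; rewrite slide_i.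
(* Needed when v is 1 at both p and i: the half step then adds 2 to [dev], the whole step 4. In the
   other cases compatible with the bounds, the whole step does not increase [dev]. *)
have k_lt : dev v <= (2 * q)%:R - 2 -> dev v <= (2 * q)%:R - 4.
  rewrite hk => h; have : k%:~R < (0 : int)%:~R :> R by rewrite /=; lra.
  rewrite ltr_int => hk0; have : k%:~R <= (-1 : int)%:~R :> R by rewrite ler_int; lia.
  by rewrite rmorphN1; lra.
have n0 : `|0 - 1 : R| = 1 by rewrite sub0r normrN1.
have n1 : `|1 - 1 : R| = 0 by rewrite subrr normr0.
have n2 : `|2 - 1 : R| = 1 by rewrite (_ : 2 - 1 = 1) ?normr1 //; ring.
have n01 : `|0 + 1 - 1 : R| = 0 by rewrite (_ : 0 + 1 - 1 = 0) ?normr0 //; ring.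
have n11 : `|1 + 1 - 1 : R| = 1 by rewrite (_ : 1 + 1 - 1 = 1) ?normr1 //; ring.
have n10 : `|1 - 1 - 1 : R| = 1.
  by rewrite (_ : 1 - 1 - 1 = -1) ?normrN1 //; ring.
have n21 : `|2 - 1 - 1 : R| = 0 by rewrite (_ : 2 - 1 - 1 = 0) ?normr0 //; ring.
have h1 : `|1 + 2^-1 - 1 : R| = 2^-1 by rewrite ger0_norm; lra.
have h2 : `|1 - 2^-1 - 1 : R| = 2^-1 by rewrite ler0_norm; lra.
case: (int_cases (vint p) (h02 p)) => ->;
  case: (int_cases (vint i) (h02 i)) => ->;
  rewrite ?n0 ?n1 ?n2 ?n01 ?n11 ?n10 ?n21 ?h1 ?h2 => ? ? ?; try lra.
Qed.

(** The entry at p is an integer plus 1/2. Hence (SP3') says nothing when i lies outside the pair p,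
    p^*. *)
Lemma far_not_integral : ~ integral_vec (slide 2^-1).
Proof.
move=> /(_ p); rewrite slide_p; have /intrP[n ->] := vint p.
by apply/negP/half_nint.
Qed.

End Far.

Lemma slide_opp : i = rev_ord p -> forall t, slide t = v + (2 * t) *: dvec R p.
Proof.
move=> ip t; rewrite /slide ip dvec_revp scalerN scaleNr opprK -addrA -scalerDl.
by congr (_ + _ *: _); ring.
Qed.

Lemma slide_same : i = p -> forall t, slide t = v.
Proof. by move=> ip t; rewrite /slide ip scaleNr addrK. Qed.

(** In the case i = p^* the half shift is v + e_p - e_{p^*}, integral and not congruent to mu. An
    entry 1 of it at p or p^* forces v to be 0 at p and 2 at p^*, and the whole shift merely
    exchanges these two entries. *)
Lemma polytope_slide : polytope q (slide 2^-1) ->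
  (integral_vec (slide 2^-1) -> ~ congr_Qvee (slide 2^-1) mu ->
    exists2 j, (j == p) || (j == rev_ord p) & slide 2^-1 ord0 j = 1) ->
  polytope q (slide 1).
Proof.
move=> hP h3; have [hs h02 hd] := vP.
have [ip|ip] := eqVneq i p; first by rewrite slide_same.
have [irp|irp] := eqVneq i (rev_ord p); last exact: far_polytope.
have E : slide 2^-1 = v + dvec R p.
  by rewrite slide_opp // mulfV ?scale1r // pnatr_eq0.
have vp : v ord0 p = 0.
  have [|| j] := h3.
  - by move=> j; rewrite E mxE rpredD // dvecE rpredB // natr_int.
  - by rewrite E; exact: dvec_not_congr.
  rewrite E mxE; case/orP => /eqP ->; first by rewrite dvec_id; lra.
  by rewrite dvec_rev dvec_id; have := hs p; lra.
rewrite slide_opp // mulr1; split; first exact: sym2_dvec.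
  move=> j; rewrite addZE; have [->|jp] := eqVneq j p.
    by rewrite vp dvec_id; lra.
  have [->|jrp] := eqVneq j (rev_ord p).
    by rewrite dvec_rev dvec_id; have := hs p; lra.
  by rewrite dvec_other // mulr0 addr0.
rewrite dev_dvec // vp add0r sub0r normrN1.
by rewrite (_ : 2 - 1 = 1 :> R) ?normr1; lra.
Qed.

(** Only i = p^* is left, and there the bounds on v and on the whole shift, which adds 2 at p, force
    v to be 0 at p. An entry 1 outside the pair exists because otherwise all entries of v would be 0
    or 2 and [dev v] would reach 2m, above 2q; it provides the other index of (SP3'). *)
Lemma slide_ones : polytope q (slide 1) ->
  integral_vec (slide 2^-1) -> ~ congr_Qvee (slide 2^-1) mu ->
  [/\ slide 2^-1 ord0 p = 1, slide 2^-1 ord0 (rev_ord p) = 1 &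
    exists j, [/\ j != p, j != rev_ord p & slide 2^-1 ord0 j = 1]].
Proof.
move=> hP hi hn; have [hs h02 hd] := vP; have [_ h02' _] := hP.
have [ip|ip] := eqVneq i p; first by move: hn; rewrite slide_same.
have [irp|irp] := eqVneq i (rev_ord p); last by case: (far_not_integral ip irp).
have E : slide 2^-1 = v + dvec R p.
  by rewrite slide_opp // mulfV ?scale1r // pnatr_eq0.
have vp : v ord0 p = 0.
  have := h02' p; have := h02 p; rewrite slide_opp // addZE dvec_id; lra.
have vrp : v ord0 (rev_ord p) = 2 by have := hs p; lra.
rewrite E; split.
- by rewrite mxE vp dvec_id add0r.
- by rewrite mxE vrp dvec_rev dvec_id; lra.
have [j /and3P[jp jrp /eqP vj]|hj] :=
  pickP (fun j => [&& j != p, j != rev_ord p & v ord0 j == 1]).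
  by exists j; rewrite jp jrp mxE vj dvec_other // addr0.
have : (2 * m)%:R <= dev v.
  have -> : (2 * m)%:R = \sum_(j < 2 * m) 1 :> R by rewrite sumr_const card_ord.
  apply: ler_sum => j _; have : v ord0 j != 1.
    have [->|jp] := eqVneq j p; first by rewrite vp; apply/eqP; lra.
    have [->|jrp] := eqVneq j (rev_ord p); first by rewrite vrp; apply/eqP; lra.
    by have := hj j; rewrite jp jrp /= => ->.
  case: (int_cases (vint j) (h02 j)) => ->.
  - by rewrite sub0r normrN1.
  - by rewrite eqxx.
  - by rewrite ger0_norm; lra.
by move=> h; have := le_trans h hd; rewrite ler_nat; lia.
Qed.

End Extension.

(** * Facets of the closed alcove *)

Section Facets.
Variables (R : realType) (m : nat).
Local Notation V := 'rV[R]_(2 * m).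
Implicit Types (a u v x y : V) (i j k l : 'I_(2 * m)) (F : set V).

(* The inequalities are imposed for all roots, not only for the walls, so that
   the facet of a point of the closed alcove can be read off from the roots
   whose value at that point is 0 or -1. *)
Definition closed_alcove x := apartment x /\
  forall i j, (i < j)%N -> j != rev_ord i -> -1 <= x ord0 i - x ord0 j <= 0.

(* u lies in the closure of the facet of v; see closure_facetP. *)
Definition incident u v := closed_alcove u /\
  forall i j, (i < j)%N -> j != rev_ord i ->
    (v ord0 i - v ord0 j = 0 -> u ord0 i - u ord0 j = 0) /\
    (v ord0 i - v ord0 j = -1 -> u ord0 i - u ord0 j = -1).

Definition facet x : set V := [set y | apartment y /\ same_facet x y].

Lemma incident_trans x y z : incident x y -> incident y z -> incident x z.
Proof.
move=> [Cx xy] [_ yz]; split=> // i j ij nr.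
have [h1 h2] := xy _ _ ij nr; have [h3 h4] := yz _ _ ij nr.
by split=> [/h3/h1|/h4/h2].
Qed.

(** For d other than 0 and -1 the sign is constant on the whole interval [-1, 0]. *)
Lemma sg_unit_interval (a b : R) (d : int) : -1 <= a <= 0 -> -1 <= b <= 0 ->
  (a = 0 <-> b = 0) -> (a = -1 <-> b = -1) ->
  Num.sg (a - d%:~R) = Num.sg (b - d%:~R).
Proof.
move=> ha hb h0 h1.
have [d1|d1] := lerP 1 d.
  have : 1 <= d%:~R :> R by rewrite ler1z.
  by move=> h; rewrite !ltr0_sg; lra.
have [d2|d2] := lerP d (-2).
  have : d%:~R <= (-2 : int)%:~R :> R by rewrite ler_int.
  rewrite rmorphN /= => h; rewrite !gtr0_sg; lra.
have [->|dn0] := eqVneq d 0.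
  rewrite !subr0; have [a0|an0] := eqVneq a 0; first by rewrite a0 (h0.1 a0).
  have bn0 : b != 0 by apply/eqP => b0; move: an0; rewrite (h0.2 b0) eqxx.
  by rewrite !ltr0_sg // lt_neqAle ?an0 ?bn0; lra.
have -> : d = -1 by lia.
rewrite rmorphN1 opprK.
have [a0|an0] := eqVneq a (-1); first by rewrite a0 (h1.1 a0).
have bn0 : b != -1 by apply/eqP => b0; move: an0; rewrite (h1.2 b0) eqxx.
have a1 : -1 < a by rewrite lt_neqAle eq_sym an0; lra.
have b1 : -1 < b by rewrite lt_neqAle eq_sym bn0; lra.
by rewrite !gtr0_sg; lra.
Qed.

Lemma sg_eq0 (a b : R) : Num.sg a = Num.sg b ->
  (a <= 0 -> b <= 0) /\ (0 <= a -> 0 <= b).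
Proof. by move=> h; rewrite -(sgr_le0 a) -(sgr_le0 b) -(sgr_ge0 a) -(sgr_ge0 b) h. Qed.

(** Reduces the infinite family of hyperplanes to the root values 0 and -1. That u lies in the
    closed alcove is part of the conclusion: the signs for d = 0 and d = -1 confine it there. *)
Lemma same_facetP v u : closed_alcove v -> apartment u ->
  same_facet v u <-> incident u v /\ incident v u.
Proof.
move=> Cv Au; split.
  move=> h.
  have hh i j (d : int) : (i < j)%N -> j != rev_ord i ->
      Num.sg (v ord0 i - v ord0 j - d%:~R) = Num.sg (u ord0 i - u ord0 j - d%:~R).
    by move=> ij nr; apply: h => //; apply/eqP => e; move: ij; rewrite e ltnn.
  have [_ hv] := Cv.
  have main i j : (i < j)%N -> j != rev_ord i ->
     [/\ -1 <= u ord0 i - u ord0 j <= 0,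
      v ord0 i - v ord0 j = 0 <-> u ord0 i - u ord0 j = 0 &
      v ord0 i - v ord0 j = -1 <-> u ord0 i - u ord0 j = -1].
    move=> ij nr; have h0 := hh i j 0 ij nr; have h1 := hh i j (-1) ij nr.
    rewrite rmorphN1 opprK !subr0 in h0 h1; have := hv _ _ ij nr.
    have [h01 h02] := sg_eq0 h0; have [h03 h04] := sg_eq0 (esym h0).
    have [h11 h12] := sg_eq0 h1; have [h13 h14] := sg_eq0 (esym h1).
    by move=> hvij; split; [lra|split; lra|split; lra].
  split; split=> //.
  - by split=> // i j ij nr; have [] := main i j ij nr.
  - by move=> i j ij nr; have [_ h1 h2] := main i j ij nr; rewrite h1 h2.
  - by move=> i j ij nr; have [_ h1 h2] := main i j ij nr; rewrite h1 h2.
move=> [[[_ Cu] uv] [_ vu]] i j d ji jri; have [_ Cv'] := Cv.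
have [ij|ij|/val_inj ij] := ltngtP (i : nat) j; last by rewrite ij eqxx in ji.
  have [h1 h2] := uv _ _ ij jri; have [h3 h4] := vu _ _ ij jri.
  by apply: sg_unit_interval; [exact: Cv'|exact: Cu|split|split].
have irj : i != rev_ord j by rewrite -rev_eqL eq_sym.
have [h1 h2] := uv _ _ ij irj; have [h3 h4] := vu _ _ ij irj.
have E x : x ord0 i - x ord0 j - d%:~R =
    - (x ord0 j - x ord0 i - (- d)%:~R) by rewrite rmorphN /=; ring.
rewrite !E !sgrN; congr (- _).
by apply: sg_unit_interval; [exact: Cv'|exact: Cu|split|split].
Qed.

Lemma facet_eq x y : same_facet x y -> facet x = facet y.
Proof.
move=> h; apply/seteqP; split=> z [Az hz]; split=> // i j d h1 h2.
  by rewrite -h // hz.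
by rewrite h // hz.
Qed.

Lemma facet_refl x : apartment x -> facet x x. Proof. by []. Qed.

Lemma closed_alcove_const x (t : R) : closed_alcove x -> closed_alcove (x + const_mx t).
Proof.
move=> [Ax hx]; split.
  by move=> i j; have := Ax i j; rewrite !mxE; lra.
by move=> i j ij nr; have := hx _ _ ij nr; rewrite !mxE; lra.
Qed.

Lemma same_facet_const x (t : R) : same_facet x (x + const_mx t).
Proof. by move=> i j d _ _; congr (Num.sg _); rewrite !mxE; ring. Qed.

Lemma closed_alcove_convex : convex_pred closed_alcove.
Proof.
move=> x y t t01 [Ax hx] [Ay hy]; split.
  by move=> i j; have := Ax i j; have := Ay i j; rewrite !mxE; nra.
move=> i j ij nr; have := hx _ _ ij nr; have := hy _ _ ij nr; rewrite !mxE.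
move=> /andP[h1 h2] /andP[h3 h4]; apply/andP; split; nra.
Qed.

(** All root values at the points lie in [-1, 0], so an average equal to 0 or to -1 forces this
    value at each point of positive weight. The constant c cancels in the roots. *)
Lemma incident_sum (I : finType) (t : I -> R) (p : I -> V) (c : R) v :
  (forall k : I, 0 <= t k) -> \sum_(k : I) t k = 1 ->
  v = const_mx c + \sum_(k : I) t k *: p k ->
  (forall k : I, closed_alcove (p k)) ->
  closed_alcove v /\ forall k : I, 0 < t k -> incident (p k) v.
Proof.
move=> t0 t1 vE Cp.
have vij i j : v ord0 i - v ord0 j = \sum_(k : I) t k * (p k ord0 i - p k ord0 j).
  rewrite vE !mxE !summxE.
  have -> (b1 b2 : R) : c + b1 - (c + b2) = b1 - b2 by ring.
  by rewrite -sumrB; apply: eq_bigr => k _; rewrite !mxE mulrBr.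
split.
  rewrite vE addrC; apply: closed_alcove_const.
  have := convex_sum closed_alcove_convex t0 (fun (k : I) _ => Cp k) (r := index_enum I).
  by rewrite t1 invr1 scale1r; apply; exact: ltr01.
move=> k tk; split=> // i j ij nr; have bnd (k' : I) := (Cp k').2 _ _ ij nr.
rewrite vij; split=> h.
  have : \sum_(k' : I) t k' * - (p k' ord0 i - p k' ord0 j) = 0.
    by under eq_bigr do rewrite mulrN; rewrite sumrN h oppr0.
  move/eqP; rewrite psumr_eq0; last first.
    by move=> k' _; rewrite mulr_ge0 //; have := bnd k'; lra.
  move/allP/(_ k (mem_index_enum k)); rewrite mulf_eq0 gt_eqF //= => /eqP; lra.
have : \sum_(k' : I) t k' * (p k' ord0 i - p k' ord0 j + 1) = 0.
  under eq_bigr do rewrite mulrDr mulr1.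
  by rewrite big_split /= h t1 addNr.
move/eqP; rewrite psumr_eq0; last first.
  by move=> k' _; rewrite mulr_ge0 //; have := bnd k'; lra.
move/allP/(_ k (mem_index_enum k)); rewrite mulf_eq0 gt_eqF //= => /eqP; lra.
Qed.

Lemma closureP F u : closure F u <->
  forall e : R, 0 < e -> exists2 v, F v & forall i, `|u ord0 i - v ord0 i| < e.
Proof.
split=> [h e e0|h B].
  have /h[v [Fv [_ hv]]] : nbhs u (ball u e) by exact: nbhsx_ballx.
  by exists v => // i; exact: hv.
move=> /nbhs_ballP[e /= e0 he]; have [v Fv hv] := h e e0.
exists v; split=> //; apply: he; split=> // i j; rewrite ord1; exact: hv.
Qed.

(** Four indices, so that one statement serves the roots (with k = l) as well as the equations of
    the apartment. *)
Lemma closure_le F u i j k l (c : R) : closure F u ->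
  (forall v, F v -> v ord0 i + v ord0 k - v ord0 j - v ord0 l <= c) ->
  u ord0 i + u ord0 k - u ord0 j - u ord0 l <= c.
Proof.
move=> /closureP hu h; rewrite leNgt; apply/negP => hc.
set D := u ord0 i + u ord0 k - u ord0 j - u ord0 l in hc.
have [|v Fv hv] := hu ((D - c) / 4); first lra.
have := h v Fv; have := hv i; have := hv j; have := hv k; have := hv l.
rewrite !ltr_norml /D; lra.
Qed.

(** Since v has positive weight, a root strictly between -1 and 0 at v remains so on the segment,
    and a root equal to 0 or -1 at v has the same value at u. *)
Lemma segment_facet u v (e : R) : closed_alcove v -> incident u v -> 0 < e <= 1 ->
  facet v (e *: v + (1 - e) *: u).
Proof.
move=> Cv uv e01; set x := _ + _.
have [Cu huv] := uv.
have Cx : closed_alcove x by apply: closed_alcove_convex => //; lra.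
split; first by case: Cx.
apply/same_facetP => //; first by case: Cx.
have E i : x ord0 i = e * v ord0 i + (1 - e) * u ord0 i by rewrite !mxE.
split; split=> // i j ij nr; have [h1 h2] := huv _ _ ij nr;
  have := Cu.2 _ _ ij nr; have := Cv.2 _ _ ij nr; rewrite !E => bv bu.
  by split=> [h|h]; [have := h1 h|have := h2 h]; nra.
have E' : e * v ord0 i + (1 - e) * u ord0 i - (e * v ord0 j + (1 - e) * u ord0 j)
    = e * (v ord0 i - v ord0 j) + (1 - e) * (u ord0 i - u ord0 j) by ring.
rewrite E'; move: (v ord0 i - v ord0 j) (u ord0 i - u ord0 j) bv bu => A B bv bu.
by split=> h; apply/eqP; rewrite eq_le; apply/andP; split; nra.
Qed.

Lemma closure_facetP v u : closed_alcove v ->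
  closure (facet v) u <-> incident u v.
Proof.
move=> Cv; split=> [hu|uv].
  have main x : facet v x -> incident x v.
    by move=> [Ax /same_facetP -/(_ Cv Ax)[]].
  have le2 i j (c : R) : (forall x, facet v x -> x ord0 i - x ord0 j <= c) ->
      u ord0 i - u ord0 j <= c.
    move=> h; have := @closure_le _ _ i j i i c hu.
    by rewrite addrAC addrK => -> // x /h; lra.
  split; first split.
  - move=> i j.
    have h1 : u ord0 i + u ord0 (rev_ord i) - u ord0 j - u ord0 (rev_ord j) <= 0.
      by apply: (closure_le hu) => x [Ax _]; have := Ax i j; lra.
    have h2 : u ord0 j + u ord0 (rev_ord j) - u ord0 i - u ord0 (rev_ord i) <= 0.
      by apply: (closure_le hu) => x [Ax _]; have := Ax i j; lra.
    lra.
  - move=> i j ij nr.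
    have h1 : u ord0 i - u ord0 j <= 0.
      by apply: le2 => x /main[[_ /(_ _ _ ij nr)]]; lra.
    have h2 : u ord0 j - u ord0 i <= 1.
      by apply: le2 => x /main[[_ /(_ _ _ ij nr)]]; lra.
    lra.
  - move=> i j ij nr; split=> h.
      have h1 : u ord0 i - u ord0 j <= 0.
        by apply: le2 => x /main[_ /(_ _ _ ij nr)[/(_ h)]]; lra.
      have h2 : u ord0 j - u ord0 i <= 0.
        by apply: le2 => x /main[_ /(_ _ _ ij nr)[/(_ h)]]; lra.
      lra.
    have h1 : u ord0 i - u ord0 j <= -1.
      by apply: le2 => x /main[_ /(_ _ _ ij nr)[_ /(_ h)]]; lra.
    have h2 : u ord0 j - u ord0 i <= 1.
      by apply: le2 => x /main[_ /(_ _ _ ij nr)[_ /(_ h)]]; lra.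
    lra.
apply/closureP => e e0.
(* S strictly exceeds every entry of u - v in absolute value, so the point of the segment with
   weight r <= e / S on v is closer than e to u. *)
pose S := 1 + \sum_i `|u ord0 i - v ord0 i|.
have S1 : 1 <= S by rewrite lerDl sumr_ge0.
have Si i : `|u ord0 i - v ord0 i| < S.
  rewrite /S (bigD1 i) //=.
  have : 0 <= \sum_(j | j != i) `|u ord0 j - v ord0 j| by apply: sumr_ge0.
  by lra.
pose r := Num.min 1 (e / S).
have r0 : 0 < r by rewrite /r lt_min ltr01 divr_gt0 //; lra.
have r1 : r <= 1 by rewrite /r ge_min lexx.
have rS : r * S <= e.
  by rewrite -ler_pdivlMr; [rewrite /r ge_min lexx orbT|lra].
exists (r *: v + (1 - r) *: u); first by apply: segment_facet => //; lra.
move=> i.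
have -> : u ord0 i - (r *: v + (1 - r) *: u) ord0 i = r * (u ord0 i - v ord0 i).
  by rewrite !mxE; ring.
rewrite normrM gtr0_norm //; apply: lt_le_trans rS.
by rewrite ltr_pM2l.
Qed.

(** A checkable criterion for the facet of a to be a line. As x_i - x_{i^*} is not a root, i and i^*
    are tied together through a third index l. *)
Definition vertexlike a := closed_alcove a /\ forall i,
  a ord0 i - a ord0 (rev_ord i) \is a Num.int /\
  exists l, [/\ l != i, l != rev_ord i & a ord0 i - a ord0 l \is a Num.int].

(** An integral root value at a is 0 or -1 and is therefore shared by u. So u - a takes the same
    value at i, l and i^*, and the equations of the apartment then make it constant. *)
Lemma vertexlike_incident a u : (0 < m)%N -> vertexlike a -> incident u a ->
  exists t, u = a + const_mx t.
Proof.
move=> m0 [Ca ha] [Cu ua].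
have dE i l : l != i -> l != rev_ord i -> a ord0 i - a ord0 l \is a Num.int ->
    u ord0 i - a ord0 i = u ord0 l - a ord0 l.
  wlog il : i l / (i < l)%N.
    move=> W li lri hil.
    have [il|il|/val_inj il] := ltngtP (i : nat) l; last by rewrite il.
      exact: W.
    apply/esym/W => //; first by rewrite eq_sym.
      by rewrite -rev_eqL eq_sym.
    by rewrite -opprB rpredN.
  move=> li lri; have := Ca.2 _ _ il lri => b /intrP[n hn].
  have [h1 h2] := ua _ _ il lri.
  have [n0|n1] : n = 0 \/ n = -1.
    move: b; rewrite hn => /andP[].
    rewrite -[-1](rmorphN1 (intmul (1 : R))) ler_int -[0]/((0 : int)%:~R) ler_int.
    by lia.
  - by have := h1 _; rewrite hn n0 => /(_ erefl); move: hn; rewrite n0 /=; lra.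
  - have := h2 _; rewrite hn n1 rmorphN1 => /(_ erefl).
    by move: hn; rewrite n1 rmorphN1; lra.
have drev i : u ord0 i - a ord0 i = u ord0 (rev_ord i) - a ord0 (rev_ord i).
  have [hi [l [li lri hl]]] := ha i; rewrite (dE i l) //.
  apply/esym/dE; rewrite ?rev_ordK //.
  have -> : a ord0 (rev_ord i) - a ord0 l =
      (a ord0 i - a ord0 l) - (a ord0 i - a ord0 (rev_ord i)) by ring.
  exact: rpredB.
have i0P : (0 < 2 * m)%N by rewrite muln_gt0.
pose i0 := Ordinal i0P.
exists (u ord0 i0 - a ord0 i0); apply/rowP => i; rewrite !mxE.
by have := drev i; have := drev i0; have := Ca.1 i i0; have := Cu.1 i i0; lra.
Qed.

Lemma facet_vertexlike a : (0 < m)%N -> vertexlike a -> facet a = line a.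
Proof.
move=> m0 va; have [Ca _] := va; apply/seteqP; split=> x.
  move=> [Ax /same_facetP -/(_ Ca Ax)[h _]].
  by have [t ->] := vertexlike_incident m0 va h; exists t.
move=> [t _ <-]; split; last exact: same_facet_const.
by case: (closed_alcove_const t Ca).
Qed.

Lemma minimal_line a v : (0 < m)%N -> closed_alcove v -> vertexlike a ->
  incident a v -> minimal_subfacet (line a) (facet v).
Proof.
move=> m0 Cv va av; have [Ca _] := va; split.
  split; first by exists a; [case: Ca|rewrite -facet_vertexlike].
  rewrite -facet_vertexlike // => x [Ax /same_facetP -/(_ Ca Ax)[h _]].
  by apply/closure_facetP => //; exact: incident_trans h av.
move=> G' [[g Ag ->] sub]; rewrite -!/(facet _) in sub *.
have /sub : facet g g by exact: facet_refl.
rewrite -facet_vertexlike // => /(closure_facetP _ Ca) h.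
have [t gE] := vertexlike_incident m0 va h.
by apply/esym/facet_eq; rewrite gE; exact: same_facet_const.
Qed.

End Facets.

(** * Vertices of the closed alcove and barycentric coordinates *)

Section AlcoveVertices.
Variables (R : realType) (m : nat).
Hypothesis hm : (2 <= m)%N.
Local Notation V := 'rV[R]_(2 * m).
Local Notation avec := (avec R m).
Local Notation avec0' := (avec0' R m).
Local Notation avecm' := (avecm' R m).
Implicit Types (a u v x y : V) (i j l : 'I_(2 * m)) (k : nat).

Lemma avecE k j : avec k ord0 j =
  if (j < k)%N then - 2^-1 else if (j < 2 * m - k)%N then 0 else 2^-1.
Proof. by rewrite mxE. Qed.

Lemma avec0'E j : avec0' ord0 j =
  if j == 0%N :> nat then -1 else if j == (2 * m - 1)%N :> nat then 1 else 0.
Proof. by rewrite mxE. Qed.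

Lemma avecm'E j : avecm' ord0 j =
  if (j < m - 1)%N then - 2^-1
  else if j == (m - 1)%N :> nat then 2^-1
  else if j == m :> nat then - 2^-1 else 2^-1.
Proof. by rewrite mxE. Qed.

Lemma rev_val j : (rev_ord j : nat) = (2 * m - j.+1)%N. Proof. by []. Qed.

Lemma neq_rev_val i j : j != rev_ord i -> (i + j)%N <> (2 * m - 1)%N.
Proof.
move=> /eqP h e; apply: h; apply: val_inj => /=; have := ltn_ord i; lia.
Qed.

Lemma avec_rev k j : (k <= m)%N -> avec k ord0 (rev_ord j) = - avec k ord0 j.
Proof.
move=> km; rewrite !avecE rev_val; have := ltn_ord j => jm.
case: (ltnP j k) => h1; case: (ltnP j (2 * m - k)) => h2;
case: (ltnP (2 * m - j.+1) k) => h3; case: (ltnP (2 * m - j.+1) (2 * m - k)) => h4;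
  rewrite ?oppr0 ?opprK //; exfalso; lia.
Qed.

Lemma avec0'_rev j : avec0' ord0 (rev_ord j) = - avec0' ord0 j.
Proof.
rewrite !avec0'E rev_val; have := ltn_ord j => jm.
case: (eqVneq (j : nat) 0%N) => h1; case: (eqVneq (j : nat) (2 * m - 1)%N) => h2;
case: (eqVneq (2 * m - j.+1)%N 0%N) => h3;
case: (eqVneq (2 * m - j.+1)%N (2 * m - 1)%N) => h4;
  rewrite ?oppr0 ?opprK //; exfalso; lia.
Qed.

Lemma avecm'_rev j : avecm' ord0 (rev_ord j) = - avecm' ord0 j.
Proof.
rewrite !avecm'E rev_val; have := ltn_ord j => jm.
case: (ltnP j (m - 1)) => h1; case: (eqVneq (j : nat) (m - 1)%N) => h2;
case: (eqVneq (j : nat) m) => h3;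
case: (ltnP (2 * m - j.+1) (m - 1)) => h4;
case: (eqVneq (2 * m - j.+1)%N (m - 1)%N) => h5;
case: (eqVneq (2 * m - j.+1)%N m) => h6;
  rewrite ?oppr0 ?opprK //; exfalso; lia.
Qed.

Lemma anti_apartment a : (forall j, a ord0 (rev_ord j) = - a ord0 j) -> apartment a.
Proof. by move=> h i j; rewrite !h !subrr. Qed.

Lemma avec_closed k : (k <= m)%N -> closed_alcove (avec k).
Proof.
move=> km; split; first by apply: anti_apartment => j; exact: avec_rev.
move=> i j ij _; rewrite !avecE.
case: (ltnP i k) => h1; case: (ltnP j k) => h2;
case: (ltnP i (2 * m - k)) => h3; case: (ltnP j (2 * m - k)) => h4;
  try (exfalso; lia); lra.
Qed.

Lemma avec0'_closed : closed_alcove avec0'.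
Proof.
split; first by apply: anti_apartment => j; exact: avec0'_rev.
move=> i j ij /neq_rev_val nr; rewrite !avec0'E.
case: (eqVneq (i : nat) 0%N) => h1; case: (eqVneq (j : nat) 0%N) => h2;
case: (eqVneq (i : nat) (2 * m - 1)%N) => h3;
case: (eqVneq (j : nat) (2 * m - 1)%N) => h4;
  have := ltn_ord i; have := ltn_ord j => ? ?; try (exfalso; lia); lra.
Qed.

Lemma avecm'_closed : closed_alcove avecm'.
Proof.
split; first by apply: anti_apartment => j; exact: avecm'_rev.
move=> i j ij /neq_rev_val nr; rewrite !avecm'E.
case: (ltnP i (m - 1)) => h1; case: (eqVneq (i : nat) (m - 1)%N) => h2;
case: (eqVneq (i : nat) m) => h3;
case: (ltnP j (m - 1)) => h4;
case: (eqVneq (j : nat) (m - 1)%N) => h5;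
case: (eqVneq (j : nat) m) => h6; try (exfalso; lia); lra.
Qed.

Definition half_pm (x : R) := x = 2^-1 \/ x = - 2^-1.

Lemma half_pm_sub (x y : R) : half_pm x -> half_pm y -> x - y \is a Num.int.
Proof.
move=> [->|->] [->|->]; rewrite ?subrr ?int_num0 //.
- by rewrite (_ : _ - _ = 1 :> R) ?int_num1 //; lra.
- by rewrite (_ : _ - _ = -1 :> R) ?rpredN ?int_num1 //; lra.
Qed.

(** Distinct indices below m lie in different conjugate pairs, at most one of which contains i. *)
Lemma other_index (n : nat) i (n' : nat) : (n < m)%N -> (n' < m)%N -> n <> n' ->
  exists2 l : 'I_(2 * m), (l : nat) = n \/ (l : nat) = n' & l != i /\ l != rev_ord i.
Proof.
move=> hn hn' nn'.
have nP : (n < 2 * m)%N by lia.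
have nP' : (n' < 2 * m)%N by lia.
have [/orP h|/norP h] := boolP ((Ordinal nP == i) || (Ordinal nP == rev_ord i)).
  exists (Ordinal nP'); first by right.
  have im := ltn_ord i; split; apply/eqP => /(congr1 val) /= e.
    by case: h => /eqP /(congr1 val) /=; lia.
  by case: h => /eqP /(congr1 val) /=; lia.
by exists (Ordinal nP); first by left.
Qed.

Lemma vertexlikeI a : closed_alcove a ->
  (forall j, a ord0 (rev_ord j) = - a ord0 j) ->
  (forall j, a ord0 j * 2 \is a Num.int) ->
  (forall i, exists2 l : 'I_(2 * m), l != i /\ l != rev_ord i & a ord0 i - a ord0 l \is a Num.int) ->
  vertexlike a.
Proof.
move=> Ca ar ah al; split=> // i; split.
  by rewrite ar opprK -mulr2n -mulr_natr.
by have [l [h1 h2] h3] := al i; exists l.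
Qed.

Lemma avec_half k j : avec k ord0 j * 2 \is a Num.int.
Proof.
rewrite avecE; case: ifP => _; last case: ifP => _.
- by rewrite mulNr mulVf ?rpredN ?int_num1 // pnatr_eq0.
- by rewrite mul0r int_num0.
- by rewrite mulVf ?int_num1 // pnatr_eq0.
Qed.

(** The partner l of i is found inside A_k or B_k, whichever contains i. For k = 1 and k = m - 1 one
    of these sets is a single conjugate pair and offers no partner. *)
Lemma avec_vertexlike k : (k <= m)%N -> k <> 1%N -> k <> (m - 1)%N ->
  vertexlike (avec k).
Proof.
move=> km k1 km1; apply: vertexlikeI.
- exact: avec_closed.
- by move=> j; exact: avec_rev.
- exact: avec_half.
move=> i; have im := ltn_ord i.
have [iA|iB] := boolP ((i < k)%N || (2 * m - k <= i)%N).
  have [l hl [li lri]] := @other_index 0 i 1 ltac:(lia) ltac:(lia) ltac:(lia).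
  exists l => //; apply: half_pm_sub; rewrite avecE.
    case/orP: iA => h; first by rewrite h; right.
    have -> : (i < k)%N = false by lia.
    have -> : (i < 2 * m - k)%N = false by lia.
    by left.
  have -> : (l < k)%N by lia.
  by right.
have [l hl [li lri]] := @other_index (m - 1) i (m - 2) ltac:(lia) ltac:(lia) ltac:(lia).
exists l => //; rewrite !avecE.
have -> : (i < k)%N = false by lia.
have -> : (i < 2 * m - k)%N by lia.
have -> : (l < k)%N = false by lia.
have -> : (l < 2 * m - k)%N by lia.
by rewrite subrr int_num0.
Qed.

Lemma avec0'_int j : avec0' ord0 j \is a Num.int.
Proof.
rewrite avec0'E; case: ifP => _; first by rewrite rpredN int_num1.
by case: ifP => _; rewrite ?int_num1 ?int_num0.
Qed.

Lemma avec0'_vertexlike : vertexlike avec0'.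
Proof.
apply: vertexlikeI.
- exact: avec0'_closed.
- exact: avec0'_rev.
- by move=> j; rewrite rpredM ?int_num2 // avec0'_int.
move=> i; have [l hl lP] := @other_index 0 i 1 ltac:(lia) ltac:(lia) ltac:(lia).
by exists l => //; rewrite rpredB // avec0'_int.
Qed.

Lemma avecm'_half j : half_pm (avecm' ord0 j).
Proof.
rewrite avecm'E; case: ifP => _; first by right.
by case: ifP => _; [left|case: ifP => _; [right|left]].
Qed.

Lemma avecm_half j : half_pm (avec m ord0 j).
Proof.
rewrite avecE; case: ifP => h1; first by right.
case: ifP => h2; [exfalso; lia|by left].
Qed.

Lemma avecm'_vertexlike : vertexlike avecm'.
Proof.
apply: vertexlikeI.
- exact: avecm'_closed.
- exact: avecm'_rev.
- move=> j; case: (avecm'_half j) => ->; rewrite ?mulNr ?rpredN mulVf ?int_num1 // pnatr_eq0 //.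
move=> i; have [l hl lP] := @other_index 0 i 1 ltac:(lia) ltac:(lia) ltac:(lia).
by exists l => //; apply: half_pm_sub; exact: avecm'_half.
Qed.

Definition vertex a := [\/ exists2 k, [/\ (k <= m)%N, k <> 1%N & k <> (m - 1)%N] & a = avec k,
   a = avec0' | a = avecm'].

Lemma vertex_vertexlike a : vertex a -> vertexlike a.
Proof.
case=> [[k [km k1 km1] ->]|->|->].
- exact: avec_vertexlike.
- exact: avec0'_vertexlike.
- exact: avecm'_vertexlike.
Qed.

Lemma midE x y j : (2^-1 *: (x + y)) ord0 j = 2^-1 * (x ord0 j + y ord0 j).
Proof. by rewrite !mxE. Qed.

Lemma avec1_mid : avec 1 = 2^-1 *: (avec 0 + avec0').
Proof.
apply/rowP => j; rewrite midE !avecE avec0'E.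
have := ltn_ord j => jm.
case: (ltnP j 1) => h1; case: (ltnP j (2 * m - 1)) => h2;
case: (ltnP j 0) => h3; case: (ltnP j (2 * m - 0)) => h4;
case: (eqVneq (j : nat) 0%N) => h5; case: (eqVneq (j : nat) (2 * m - 1)%N) => h6;
  try (exfalso; lia); lra.
Qed.

Lemma avecm1_mid : avec (m - 1) = 2^-1 *: (avec m + avecm').
Proof.
apply/rowP => j; rewrite midE !avecE avecm'E.
have := ltn_ord j => jm.
case: (ltnP j (m - 1)) => h1; case: (ltnP j (2 * m - (m - 1))) => h2;
case: (ltnP j m) => h3; case: (ltnP j (2 * m - m)) => h4;
case: (eqVneq (j : nat) (m - 1)%N) => h5; case: (eqVneq (j : nat) m) => h6;
  try (exfalso; lia); lra.
Qed.

Lemma incident_mid a b : closed_alcove a -> closed_alcove b ->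
  incident a (2^-1 *: (a + b)) /\ incident b (2^-1 *: (a + b)).
Proof.
move=> Ca Cb.
by split; split=> // i j ij nr; have := Ca.2 _ _ ij nr; have := Cb.2 _ _ ij nr;
  rewrite !midE => ? ?; split; lra.
Qed.

(* For m = 2 the alcove is a square, not a simplex, and for m > 2 its
   vertices do not include a_1 and a_{m-1}. The points a_0, ..., a_m span one
   of the four smaller simplices into which the reflections exchanging a_0 with
   a_0' and a_m with a_m' cut it; these reflections carry v into that simplex,
   where barycentric coordinates are twice the successive differences of the
   coordinates. *)
Lemma decomposition v : closed_alcove v ->
  exists (c : R) (t : 'I_m.+1 -> R) (P0 Pm : V),
  [/\ P0 = avec 0 \/ P0 = avec0', Pm = avec m \/ Pm = avecm',
      (forall k : 'I_m.+1, 0 <= t k), \sum_(k < m.+1) t k = 1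
    & v = const_mx c + \sum_(k < m.+1) t k *:
        (if k == 0%N :> nat then P0 else if k == m :> nat then Pm else avec k)].
Proof.
move=> [Av hv].
have i0P : (0 < 2 * m)%N by lia.
have m0P : (0 < m)%N by lia.
have m1P : (0 < m - 1)%N by lia.
have mlt : (m - 1 < m)%N by lia.
have oneSm : (1 == m.+1) = false by lia.
have mn0 : (m == 0%N) = false by lia.
have mSm : (m == m.+1) = false by lia.
pose i0 := Ordinal i0P.
pose c := 2^-1 * (v ord0 i0 + v ord0 (rev_ord i0)).
have crev j : v ord0 (rev_ord j) = 2 * c - v ord0 j.
  by rewrite /c; have := Av j i0; lra.
(* Centred coordinates, extended by 0 to all naturals for the telescoping sums. *)
pose f n := if insub n is Some j then v ord0 (j : 'I_(2 * m)) - c else 0.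
have fE j : f j = v ord0 j - c by rewrite /f valK.
have fP (i' j' : nat) : (i' < j')%N -> (j' < m)%N ->
    [/\ f i' <= f j', f i' + f j' <= 0, -1 <= f i' + f j' & f j' <= f i' + 1].
  move=> ij jm; have iP : (i' < 2 * m)%N by lia.
  have jP : (j' < 2 * m)%N by lia.
  pose i := Ordinal iP; pose j := Ordinal jP.
  have -> : f i' = v ord0 i - c by exact: (fE i).
  have -> : f j' = v ord0 j - c by exact: (fE j).
  have h1 : -1 <= v ord0 i - v ord0 j <= 0.
    by apply: hv => //; apply/eqP => /(congr1 val) /=; lia.
  have h2 : -1 <= v ord0 i - v ord0 (rev_ord j) <= 0.
    apply: hv; first by rewrite /=; lia.
    by apply/eqP => /(congr1 val) /=; lia.
  by move: h2; rewrite crev; split; lra.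
(* The coordinates after the two reflections: the first becomes the larger of x and -1 - x, the last
   one of the lower half becomes -|x|. *)
pose g n := if n == 0%N then Num.max (f 0%N) (-1 - f 0%N)
  else if n == (m - 1)%N then - `|f n| else f n.
(* Shifted by one and bordered by -1/2 and 0, so that the weights [t] telescope to 1. *)
pose G n := if n == 0%N then - 2^-1 else if n == m.+1 then 0 else g n.-1.
pose t (k : nat) := 2 * (G k.+1 - G k).
have sumt n : (n <= m.+1)%N -> \sum_(n <= k < m.+1) t k = - 2 * G n.
  move=> nm; rewrite -mulr_sumr telescope_sumr //.
  by rewrite [G m.+1]/G /= eqxx; ring.
have g_last : g (m - 1)%N = - `|f (m - 1)%N|.
  by rewrite /g; case: eqP => [|_]; [lia|rewrite eqxx].
have t0 k : (k <= m)%N -> 0 <= t k.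
  move=> km; rewrite /t mulr_ge0 // subr_ge0 /G.
  have [->|k0] := eqVneq k 0%N.
    rewrite /= (_ : 1 == m.+1 = false) /g /=; last by lia.
    by rewrite le_max; apply/orP; case: (lerP (- 2^-1) (f 0%N)) => h; [left|right; lra].
  rewrite /= (_ : (k == m.+1) = false); last by lia.
  have [kSm|kSm] := eqVneq k m.
    have -> : k.-1 = (m - 1)%N by lia.
    by rewrite eqSS kSm eqxx g_last oppr_le0.
  rewrite eqSS (negPf kSm).
  have kb : (k.-1 < k)%N by lia.
  have kltm : (k < m)%N by lia.
  have [f1 f2 f3 f4] := fP _ _ kb kltm.
  have gk : g k = if k == (m - 1)%N then - `|f k| else f k.
    by rewrite /g (negPf k0).
  have gk1 : g k.-1 = if k.-1 == 0%N then Num.max (f 0%N) (-1 - f 0%N) else f k.-1.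
    rewrite /g; case: ifP => // _; case: eqP => // e; exfalso; lia.
  rewrite gk gk1.
  have fk : f k.-1 <= (if k == (m - 1)%N then - `|f k| else f k).
    by case: ifP => _ //; rewrite lerNr ler_norml; lra.
  have fk' : -1 - f k.-1 <= (if k == (m - 1)%N then - `|f k| else f k).
    by case: ifP => _; [rewrite lerNr ler_norml|]; lra.
  by case: eqP => // e; rewrite e in fk fk'; rewrite ge_max fk fk'.
(* The ends undo the reflections: a_0' and a_m' are chosen exactly where g differs from f. *)
pose P0 : V := if f 0%N < - 2^-1 then avec0' else avec 0.
pose Pm : V := if 0 < f (m - 1)%N then avecm' else avec m.
exists c, (fun k => t k), P0, Pm; split.
- by rewrite /P0; case: ifP; [right|left].
- by rewrite /Pm; case: ifP; [right|left].
- by move=> k; apply: t0; have := ltn_ord k; lia.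
- by rewrite -(big_mkord predT) /= sumt // /G eqxx; lra.
pose p (k : nat) : V := if k == 0%N then P0 else if k == m then Pm else avec k.
have pE k j : (k <= m)%N -> p k ord0 j = avec k ord0 j
   + (if k == 0%N then P0 ord0 j - avec 0 ord0 j else 0)
   + (if k == m then Pm ord0 j - avec m ord0 j else 0).
  rewrite /p; case: eqP => [->|_] km.
    by rewrite (_ : 0%N == m = false) ?addr0; [ring|lia].
  by case: eqP => [->|_]; rewrite ?addr0 //; ring.
have prev k j : (k <= m)%N -> p k ord0 (rev_ord j) = - p k ord0 j.
  move=> km; rewrite /p /P0 /Pm; case: ifP => _.
    by case: ifP => _; rewrite ?avec0'_rev ?avec_rev.
  by case: ifP => _; [case: ifP => _|]; rewrite ?avecm'_rev ?avec_rev.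
apply/rowP => j; rewrite mxE mxE summxE.
have -> : \sum_(k < m.+1) (t k *: p k) ord0 j = \sum_(k < m.+1) t k * p k ord0 j.
  by apply: eq_bigr => k _; rewrite mxE.
wlog jm : j / (j < m)%N.
  move=> W; have [|jm] := ltnP j m; first exact: W.
  have := W (rev_ord j); rewrite low_rev -leqNgt => /(_ jm).
  have -> : \sum_(k < m.+1) t k * p k ord0 (rev_ord j) =
      - \sum_(k < m.+1) t k * p k ord0 j.
    rewrite -sumrN; apply: eq_bigr => k _; rewrite prev ?mulrN //.
    by have := ltn_ord k; lia.
  by rewrite crev; lra.
have -> : \sum_(k < m.+1) t k * p k ord0 j = \sum_(k < m.+1) t k * avec k ord0 j
    + t 0%N * (P0 ord0 j - avec 0 ord0 j) + t m * (Pm ord0 j - avec m ord0 j).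
  have -> : t 0%N * (P0 ord0 j - avec 0 ord0 j) =
      \sum_(k < m.+1) (if k == ord0 then t 0%N * (P0 ord0 j - avec 0 ord0 j) else 0).
    by rewrite -big_mkcond big_pred1_eq.
  have -> : t m * (Pm ord0 j - avec m ord0 j) =
      \sum_(k < m.+1) (if k == ord_max then t m * (Pm ord0 j - avec m ord0 j) else 0).
    by rewrite -big_mkcond big_pred1_eq.
  rewrite -!big_split /=; apply: eq_bigr => k _; rewrite pE; last by have := ltn_ord k; lia.
  rewrite -[k == ord0]/(k == 0%N :> nat) -[k == ord_max]/(k == m :> nat) !mulrDr.
  congr (_ + _ + _).
    by case: eqP => [->|_]; rewrite ?mulr0 // mulrDr.
  by case: eqP => [->|_]; rewrite ?mulr0 // mulrDr.
(* In the lower half a_k is -1/2 at the indices below k and 0 elsewhere, so only the weights with k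
   > j remain. *)
have -> : \sum_(k < m.+1) t k * avec k ord0 j = g j.
  rewrite (eq_bigr (fun k : 'I_m.+1 => if (j < k)%N then - 2^-1 * t k else 0)).
    rewrite -big_mkcond /= -mulr_sumr.
    have -> : \sum_(k < m.+1 | (j < k)%N) t k = \sum_(j.+1 <= k < m.+1) t k.
      rewrite big_geq_mkord; apply: eq_bigl => k; by [].
    rewrite sumt; last by lia.
    rewrite /G /= (_ : (j.+1 == m.+1) = false); last by lia.
    by rewrite mulrA mulNr mulrN opprK mulVf ?mul1r // pnatr_eq0.
  move=> k _; rewrite avecE; case: ifP => _; first by rewrite mulrC.
  rewrite (_ : (j < 2 * m - k)%N) ?mulr0 //; have := ltn_ord k; lia.
have vE : v ord0 j = c + f j by rewrite fE; ring.
rewrite vE -!addrA; congr (_ + _).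
have [j0|j0] := eqVneq (j : nat) 0%N.
  have -> : Pm ord0 j - avec m ord0 j = 0.
    rewrite /Pm; case: ifP => _; rewrite ?subrr // avecm'E avecE j0.
    by rewrite m1P m0P subrr.
  rewrite mulr0 addr0 j0 /g /t /P0 /G /= oneSm /g /=; case: ltP => h.
    rewrite avec0'E avecE j0 /= subn0 i0P.
    by rewrite max_r; lra.
  by rewrite subrr max_l; lra.
have -> : P0 ord0 j - avec 0 ord0 j = 0.
  rewrite /P0; case: ifP => _; rewrite ?subrr // avec0'E avecE (negPf j0) /=.
  have -> : (j == (2 * m - 1)%N :> nat) = false by clear -jm hm; lia.
  by rewrite subn0 ltn_ord subrr.
rewrite mulr0 add0r /t (_ : G m.+1 = 0); last by rewrite /G /= eqxx.
have -> : G m = - `|f (m - 1)%N|.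
  by rewrite -g_last /G mn0 mSm subn1.
rewrite /g (negPf j0); case: ifP => [/eqP jm1|jm1].
  rewrite jm1 /Pm; case: ltP => h.
    rewrite avecm'E avecE jm1 ltnn eqxx mlt.
    by rewrite gtr0_norm //; lra.
  by rewrite subrr ler0_norm //; lra.
have -> : Pm ord0 j - avec m ord0 j = 0.
  rewrite /Pm; case: ifP => _; rewrite ?subrr // avecm'E avecE jm.
  have -> : (j < m - 1)%N by clear -jm jm1 hm; lia.
  by rewrite subrr.
by rewrite mulr0 addr0.
Qed.

End AlcoveVertices.

(** * Minimal subfacets and the facet spanned by an index set *)

Section BaseAlcove.
Variables (R : realType) (m : nat).
Hypothesis hm : (2 <= m)%N.
Local Notation V := 'rV[R]_(2 * m).
Local Notation avec := (avec R m).
Local Notation avec0' := (avec0' R m).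
Local Notation avecm' := (avecm' R m).
Implicit Types (a u v x y : V) (i j l : 'I_(2 * m)) (I : {set 'I_m.+1}).

Definition translation_inv (P : V -> Prop) :=
  forall x (t : R), P x -> P (x + const_mx t).

Lemma vertex_avec0 : vertex (avec 0).
Proof. by apply: Or31; exists 0%N => //; split; lia. Qed.

Lemma vertex_avecm : vertex (avec m).
Proof. by apply: Or31; exists m => //; split; lia. Qed.

Lemma incident_avec1 : incident (avec 0) (avec 1) /\ incident avec0' (avec 1).
Proof.
rewrite (avec1_mid R hm); apply: incident_mid => //; last exact: avec0'_closed.
by apply: avec_closed.
Qed.

Lemma incident_avecm1 :
  incident (avec m) (avec (m - 1)) /\ incident avecm' (avec (m - 1)).
Proof.
rewrite (avecm1_mid R hm); apply: incident_mid => //; last exact: avecm'_closed.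
by apply: avec_closed.
Qed.

(** The decomposition may use a_1 and a_{m-1}, which are not vertices; each is replaced by the two
    vertices of which it is the midpoint, and these are incident to v by transitivity. *)
Lemma closed_alcove_ind v (P : V -> Prop) : convex_pred P ->
  translation_inv P -> closed_alcove v ->
  (forall a, vertex a -> incident a v -> P a) -> P v.
Proof.
move=> cP tP Cv h.
have [c [t [P0 [Pm [hP0 hPm t0 t1 vE]]]]] := decomposition hm Cv.
set p := fun k : 'I_m.+1 => if k == 0%N :> nat then P0
  else if k == m :> nat then Pm else avec k.
have vtx (k : 'I_m.+1) : [\/ vertex (p k),
    p k = avec 1 | p k = avec (m - 1)].
  rewrite /p; case: eqP => [_|k0].
    apply: Or31; case: hP0 => ->; [exact: vertex_avec0|exact: Or32].
  case: eqP => [_|km].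
    by apply: Or31; case: hPm => ->; [exact: vertex_avecm|exact: Or33].
  have [->|k1] := eqVneq (k : nat) 1%N; first exact: Or32.
  have [->|k2] := eqVneq (k : nat) (m - 1)%N; first exact: Or33.
  apply: Or31; apply: Or31; exists k => //.
  by split; [have := ltn_ord k; lia|exact/eqP|exact/eqP].
have Cp k : closed_alcove (p k).
  case: (vtx k) => [/(vertex_vertexlike hm)[]//|->|->]; apply: avec_closed; lia.
have inc (k : 'I_m.+1) : 0 < t k -> incident (p k) v.
  by have [_] := incident_sum t0 t1 vE Cp; apply.
have Pp k : 0 < t k -> P (p k).
  move=> /inc pk; case: (vtx k) => [vk|e|e]; first exact: h.
    rewrite e in pk *; have [h1 h2] := incident_avec1.
    rewrite (avec1_mid R hm); apply: (convex_mid cP); apply: h.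
    - exact: vertex_avec0.
    - exact: incident_trans h1 pk.
    - exact: Or32.
    - exact: incident_trans h2 pk.
  rewrite e in pk *; have [h1 h2] := incident_avecm1.
  rewrite (avecm1_mid R hm); apply: (convex_mid cP); apply: h.
  - exact: vertex_avecm.
  - exact: incident_trans h1 pk.
  - exact: Or33.
  - exact: incident_trans h2 pk.
rewrite vE addrC; apply: tP.
have := convex_sum cP t0 Pp (r := index_enum 'I_m.+1).
by rewrite t1 invr1 scale1r; apply; exact: ltr01.
Qed.

(** Induction for a predicate that ignores its argument. *)
Lemma exists_vertex v : closed_alcove v ->
  exists2 a, vertex a & incident a v.
Proof.
move=> Cv; apply: (@closed_alcove_ind v (fun _ => exists2 a, vertex a & incident a v)) => //.
by move=> a va av; exists a.
Qed.

(** Every subfacet has a vertex, and the line through that vertex is again a subfacet; minimality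
    makes the two equal. *)
Lemma minimal_subfacets v : closed_alcove v ->
  [set G | minimal_subfacet G (facet v)] =
  @line R m @` [set a | vertex a /\ incident a v].
Proof.
move=> Cv; have m0 : (0 < m)%N by lia.
apply/seteqP; split=> G.
  move=> [[[g Ag GE] sub] hmin]; rewrite -/(facet g) in GE.
  have gv : incident g v.
    by apply/closure_facetP => //; apply: sub; rewrite GE; exact: facet_refl.
  have [Cg _] := gv.
  have [a va ag] := exists_vertex Cg; exists a.
    by split=> //; exact: incident_trans ag gv.
  apply: hmin; rewrite GE.
  by have [] := minimal_line m0 Cg (vertex_vertexlike hm va) ag.
move=> [a [va av] <-]; apply: minimal_line => //.
exact: vertex_vertexlike.
Qed.

(* Averaging the a_k, k in I, also for k = 1 and k = m - 1: these two are the
   midpoints of a_0, a_0' and of a_m, a_m'. *)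
Definition barycenter I : V :=
  \sum_(k < m.+1) (if k \in I then #|I|%:R^-1 else 0) *: avec k.

Section Face.
Variable I : {set 'I_m.+1}.
Hypotheses (I0 : I != finset.set0) (Ic : index_cond I).

Let w (k : 'I_m.+1) : R := if k \in I then #|I|%:R^-1 else 0.

Lemma w_sum : \sum_(k < m.+1) w k = 1.
Proof.
rewrite /w -big_mkcond sumr_const -[X in X *+ _]mul1r -mulrnAr -mulr_natr mulVf ?mul1r //.
by rewrite pnatr_eq0 -lt0n card_gt0.
Qed.

Lemma barycenter_incident :
  closed_alcove (barycenter I) /\
  forall k : 'I_m.+1, k \in I -> incident (avec k) (barycenter I).
Proof.
have w0 k : 0 <= w k by rewrite /w; case: ifP => // _; rewrite invr_ge0.
have E : barycenter I = const_mx 0 + \sum_(k < m.+1) w k *: avec k.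
  by rewrite [const_mx 0](_ : _ = 0) ?add0r //; apply/rowP => j; rewrite !mxE.
have Cp (k : 'I_m.+1) : closed_alcove (avec k).
  by apply: avec_closed => //; have := ltn_ord k; lia.
have [h1 h2] := incident_sum w0 w_sum E Cp; split=> // k kI; apply: h2.
by rewrite /w kI invr_gt0 ltr0n card_gt0.
Qed.

Lemma barycenter_diff i j (c : R) :
  (forall k : 'I_m.+1, k \in I -> avec k ord0 i - avec k ord0 j = c) ->
  barycenter I ord0 i - barycenter I ord0 j = c.
Proof.
move=> h; rewrite /barycenter !summxE -sumrB.
rewrite (eq_bigr (fun k => w k * c)); first by rewrite -mulr_suml w_sum mul1r.
move=> k _; rewrite [X in X - _]mxE [X in _ - X]mxE -mulrBr -/(w k).
by have [kI|kI] := boolP (k \in I); [rewrite h|rewrite /w (negPf kI) !mul0r].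
Qed.

(** A vertex that is not listed is excluded by a root with constant value 0 or -1 at the a_k, k in
    I, and another value at that vertex: x_2 - x_{2m} for a_0, x_{m-1} - x_{m+1} for a_m, x_n -
    x_{n+1} for the other a_n, x_1 - x_2 for a_0', and x_{m-1} - x_m for a_m'. *)
Lemma FI_verticesE :
  FI_vertices I = [set a : V | vertex a /\ incident a (barycenter I)].
Proof.
have [CB inc] := barycenter_incident.
have N n : (n < 2 * m)%N -> {i : 'I_(2 * m) | (i : nat) = n}.
  by move=> h; exists (Ordinal h).
apply/seteqP; split=> a.
  move=> [k kI]; have := inc k kI => kB.
  have km : (k <= m)%N by have := ltn_ord k; lia.
  case=> [[k1 k2 ->]|[k1 ->]|[k1 ->]].
  - by split=> //; apply: Or31; exists k.
  - split; first exact: Or32.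
    by rewrite k1 in kB; exact: incident_trans incident_avec1.2 kB.
  - split; first exact: Or33.
    by rewrite k1 in kB; exact: incident_trans incident_avecm1.2 kB.
move=> [va [Ca aB]].
have wall0 i j : (i < j)%N -> j != rev_ord i ->
    (forall k : 'I_m.+1, k \in I -> avec k ord0 i = avec k ord0 j) ->
    a ord0 i = a ord0 j.
  move=> ij nr h; have [/(_ _)h0 _] := aB _ _ ij nr.
  apply/eqP; rewrite -subr_eq0; apply/eqP/h0/barycenter_diff => k kI.
  by rewrite h // subrr.
have wall1 i j : (i < j)%N -> j != rev_ord i ->
    (forall k : 'I_m.+1, k \in I -> avec k ord0 i - avec k ord0 j = -1) ->
    a ord0 i - a ord0 j = -1.
  by move=> ij nr h; have [_ h0] := aB _ _ ij nr; exact/h0/barycenter_diff.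
have nr_of i j : (i + j <> 2 * m - 1)%N -> j != rev_ord i.
  move=> h; apply/eqP => e; apply: h; rewrite e /=; have := ltn_ord i; lia.
have i0 := N 0%N ltac:(lia); have i1 := N 1%N ltac:(lia).
have il := N (2 * m - 1)%N ltac:(lia); have im1 := N (m - 1)%N ltac:(lia).
have im2 := N (m - 2)%N ltac:(lia); have im := N m ltac:(lia).
case: i0 i1 il im1 im2 im => [i0 i0E] [i1 i1E] [il ilE] [im1 im1E] [im2 im2E] [im imE].
case: va => [[n [nm n1 nm1] aE]|aE|aE].
- have nP : (n < m.+1)%N by lia.
  exists (Ordinal nP); last by apply: Or31.
  apply/negPn/negP => nI.
  have nk (k : 'I_m.+1) : k \in I -> (k : nat) <> n.
    by move=> kI e; move: nI; rewrite (_ : Ordinal nP = k) ?kI //; apply: val_inj.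
  have [n0|n0] := eqVneq n 0%N.
    (* As 0 is not in I, [index_cond] excludes 1 as well, and every k in I is at least 2. *)
    have no1 (k : 'I_m.+1) : k \in I -> (k : nat) <> 1%N.
      move=> kI e; have [/(_ e) h _] := Ic kI.
      by apply: (nk _ h); rewrite n0.
    have : a ord0 i1 - a ord0 il = -1.
      apply: wall1; [lia|by apply: nr_of; lia|move=> k kI].
      have := nk k kI; have := no1 k kI; have := ltn_ord k => h1 h2 h3.
      rewrite !avecE i1E ilE.
      have -> : (1 < k)%N by lia.
      have -> : (2 * m - 1 < k)%N = false by lia.
      have -> : (2 * m - 1 < 2 * m - k)%N = false by lia.
      lra.
    rewrite aE n0 !avecE /= i1E ilE subn0.
    have -> : (1 < 2 * m)%N by lia.
    have -> : (2 * m - 1 < 2 * m)%N by lia.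
    lra.
  have [nEm|nNm] := eqVneq n m.
    have no1 (k : 'I_m.+1) : k \in I -> (k : nat) <> (m - 1)%N.
      move=> kI e; have [_ /(_ e) h] := Ic kI.
      by apply: (nk _ h); rewrite nEm.
    have : a ord0 im2 = a ord0 im.
      apply: wall0; [lia|by apply: nr_of; lia|move=> k kI].
      have := nk k kI; have := no1 k kI; have := ltn_ord k => h1 h2 h3.
      rewrite !avecE im2E imE.
      have -> : (m - 2 < k)%N = false by lia.
      have -> : (m - 2 < 2 * m - k)%N by lia.
      have -> : (m < k)%N = false by lia.
      by have -> : (m < 2 * m - k)%N by lia.
    rewrite aE nEm !avecE im2E imE.
    have -> : (m - 2 < m)%N by lia.
    have -> : (m < m)%N = false by lia.
    have -> : (m < 2 * m - m)%N = false by lia.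
    lra.
  have [in1 in1E] := N (n - 1)%N ltac:(lia); have [inn innE] := N n ltac:(lia).
  have : a ord0 in1 = a ord0 inn.
    apply: wall0; [lia|by apply: nr_of; lia|move=> k kI].
    have := nk k kI; have := ltn_ord k => h1 h2.
    rewrite !avecE in1E innE.
    have -> : (n - 1 < 2 * m - k)%N by lia.
    have -> : (n < 2 * m - k)%N by lia.
    by have -> : (n - 1 < k)%N = (n < k)%N by lia.
  rewrite aE !avecE in1E innE.
  have -> : (n - 1 < n)%N by lia.
  have -> : (n < n)%N = false by lia.
  have -> : (n < 2 * m - n)%N by lia.
  lra.
- have [/existsP[k /andP[kI /eqP k1]]|/existsP nk] :=
    boolP [exists k : 'I_m.+1, (k \in I) && (k == 1%N :> nat)].
    by exists k => //; apply: Or32.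
  have no1 (k : 'I_m.+1) : k \in I -> (k : nat) <> 1%N.
    by move=> kI e; apply: nk; exists k; rewrite kI e eqxx.
  have : a ord0 i0 = a ord0 i1.
    apply: wall0; [lia|by apply: nr_of; lia|move=> k kI].
    have := no1 k kI; have := ltn_ord k => h1 h2.
    rewrite !avecE i0E i1E.
    have -> : (0 < 2 * m - k)%N by lia.
    have -> : (1 < 2 * m - k)%N by lia.
    by have -> : (0 < k)%N = (1 < k)%N by lia.
  rewrite aE !avec0'E i0E i1E /=.
  have -> : (1 == 2 * m - 1)%N = false by lia.
  lra.
have [/existsP[k /andP[kI /eqP k1]]|/existsP nk] :=
  boolP [exists k : 'I_m.+1, (k \in I) && (k == (m - 1)%N :> nat)].
  by exists k => //; apply: Or33.
have no1 (k : 'I_m.+1) : k \in I -> (k : nat) <> (m - 1)%N.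
  by move=> kI e; apply: nk; exists k; rewrite kI e eqxx.
have : a ord0 im2 = a ord0 im1.
  apply: wall0; [lia|by apply: nr_of; lia|move=> k kI].
  have := no1 k kI; have := ltn_ord k => h1 h2.
  rewrite !avecE im2E im1E.
  have -> : (m - 2 < 2 * m - k)%N by lia.
  have -> : (m - 1 < 2 * m - k)%N by lia.
  by have -> : (m - 2 < k)%N = (m - 1 < k)%N by lia.
rewrite aE !avecm'E im2E im1E eqxx.
have -> : (m - 2 < m - 1)%N by lia.
have -> : (m - 1 < m - 1)%N = false by lia.
lra.
Qed.

End Face.

(** In coordinates f centred at c, reversal is a sign change and every root in question is, up to
    sign, a difference or a sum of two entries of the lower half. The walls bound these by way of
    the extreme entries [i0] and [im1]. *)
Lemma base_alcove_closed x : base_alcove x -> closed_alcove x.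
Proof.
move=> [Ax h0 h1]; split=> //.
have i0P : (0 < 2 * m)%N by lia.
have im1P : (m - 1 < 2 * m)%N by lia.
pose i0 := Ordinal i0P; pose im1 := Ordinal im1P.
have crev j : x ord0 (rev_ord j) = x ord0 i0 + x ord0 (rev_ord i0) - x ord0 j.
  by have := Ax j i0; lra.
pose c := 2^-1 * (x ord0 i0 + x ord0 (rev_ord i0)).
pose f j := x ord0 j - c.
have rE j : x ord0 (rev_ord j) = c - f j by rewrite crev /f /c; lra.
have xE j : x ord0 j = c + f j by rewrite /f; ring.
have low_lt i j : (i < j)%N -> (j < m)%N -> f i < f j.
  move=> ij jm; have [i0'|i0'] := eqVneq (i : nat) 0%N.
    by have [] := h0 i j i0' ltac:(lia); rewrite !xE; lra.
  have := h1 i j ltac:(lia) ltac:(lia) ltac:(lia); rewrite !xE; lra.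
have revm1 : (rev_ord im1 : nat) = m by rewrite /=; lia.
have low_neg i : (i < m - 1)%N -> f i < - f im1.
  move=> ij; have [i0'|i0'] := eqVneq (i : nat) 0%N.
    by have [] := h0 i (rev_ord im1) i0' ltac:(rewrite revm1; lia); rewrite rE !xE; lra.
  have := h1 i (rev_ord im1) ltac:(lia) ltac:(lia) ltac:(rewrite revm1; lia).
  by rewrite rE !xE; lra.
have neg i : (i < m - 1)%N -> f i < 0.
  move=> im; have := low_neg i im.
  by have := low_lt i im1 im ltac:(rewrite /=; lia); lra.
have low0 j : (0 < j)%N -> (j < m)%N -> -1 - f i0 < f j.
  by move=> j0 jm; have [] := h0 i0 j erefl ltac:(lia); rewrite rE !xE; lra.
have low0m : -1 - f i0 < - f im1.
  have [] := h0 i0 (rev_ord im1) erefl ltac:(rewrite revm1; lia).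
  by rewrite !rE !xE; lra.
have im1E i : (i < m)%N -> ~~ (i < m - 1)%N -> i = im1.
  by move=> h2 h3; apply: val_inj => /=; lia.
have f00 : f i0 < 0 by apply: neg; rewrite /=; lia.
have diff i j : (i < j)%N -> (j < m)%N -> f j - f i < 1.
  move=> ij jm.
  have jle : f j < 1 + f i0 \/ f j < 0.
    have [jm1|jm1] := boolP (j < m - 1)%N; first by right; exact: neg.
    by left; rewrite (im1E j jm jm1); lra.
  have [i0'|i0'] := eqVneq (i : nat) 0%N.
    have -> : i = i0 by apply: val_inj.
    have := low0 j ltac:(lia) jm; case: jle; lra.
  have := low0 i ltac:(lia) ltac:(lia).
  have : f j <= - f i0.
    have [jm1|jm1] := boolP (j < m - 1)%N; first by have := neg j jm1; lra.
    by have := low_neg i0 ltac:(rewrite /=; lia); rewrite (im1E j jm jm1); lra.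
  lra.
have sum i j : (i < j)%N -> (j < m)%N -> -1 < f i + f j < 0.
  move=> ij jm; apply/andP; split.
    have [i0'|i0'] := eqVneq (i : nat) 0%N.
      have -> : i = i0 by apply: val_inj.
      by have := low0 j ltac:(lia) jm; lra.
    have := low0 i ltac:(lia) ltac:(lia).
    by have := low_lt i0 j ltac:(rewrite /=; lia) jm; lra.
  have im : (i < m - 1)%N by lia.
  have [jm1|jm1] := boolP (j < m - 1)%N.
    by have := neg i im; have := neg j jm1; lra.
  by have := low_neg i im; rewrite (im1E j jm jm1); lra.
have xrev j : x ord0 j = c - f (rev_ord j).
  by rewrite -{1}(rev_ordK j) rE.
move=> i j ij nr.
have [jm|jm] := ltnP j m.
  by have := low_lt i j ij jm; have := diff i j ij jm; rewrite !xE; lra.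
have jm' : (rev_ord j < m)%N by rewrite low_rev -leqNgt.
have [im|im] := ltnP i m.
  have [h|h|h] := ltngtP (i : nat) (rev_ord j : nat).
  - by have := sum _ _ h jm'; rewrite (xrev j) xE; lra.
  - by have := sum _ _ h im; rewrite (xrev j) xE; lra.
  - by case/negP: nr; apply/eqP/val_inj; move: h => /= h; have := ltn_ord j; lia.
have h : (rev_ord j < rev_ord i)%N by rewrite /=; have := ltn_ord j; lia.
have im' : (rev_ord i < m)%N by rewrite low_rev -leqNgt.
by have := low_lt _ _ h im'; have := diff _ _ h im'; rewrite !xrev; lra.
Qed.

End BaseAlcove.

(** * The points of F_I and the elements fixing them *)

Section FaceOfIndexSet.
Variables (R : realType) (m : nat).
Hypothesis hm : (2 <= m)%N.
Local Notation V := 'rV[R]_(2 * m).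
Local Notation avec := (avec R m).
Local Notation avec0' := (avec0' R m).
Local Notation avecm' := (avecm' R m).
Implicit Types (a u v x y : V) (i j l : 'I_(2 * m)) (I J : {set 'I_m.+1}).

Local Notation rho := (barycenter R [set: 'I_m.+1]%SET).

(** A root equal to 0 or -1 at [rho] would have that value at every a_k. But all roots vanish at
    a_0, and, in 1-based indices, a_k with k = i (or k = j^* if i > m) has different entries at i
    and j. *)
Lemma rho_generic i j : (i < j)%N -> j != rev_ord i ->
  rho ord0 i - rho ord0 j <> 0 /\ rho ord0 i - rho ord0 j <> -1.
Proof.
move=> ij nr; have T0 : [set: 'I_m.+1]%SET != finset.set0.
  by apply/set0Pn; exists ord0; rewrite inE.
have inc k : (k <= m)%N -> incident (avec k) rho.
  move=> km; have kP : (k < m.+1)%N by lia.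
  by have [_] := barycenter_incident R hm T0; move/(_ (Ordinal kP)); apply; rewrite inE.
split=> h.
  have h' k : (k <= m)%N -> avec k ord0 i - avec k ord0 j = 0.
    by move=> /inc[_ /(_ _ _ ij nr)[/(_ h)]].
  have jm := ltn_ord j; have [im|im] := ltnP i m.
    have := h' i.+1 im; rewrite !avecE ltnSn.
    have -> : (j < i.+1)%N = false by lia.
    by case: ifP => _; lra.
  have := h' (2 * m - j)%N ltac:(lia); rewrite !avecE.
  have -> : (i < 2 * m - j)%N = false by lia.
  have -> : (j < 2 * m - j)%N = false by lia.
  have -> : (i < 2 * m - (2 * m - j))%N by lia.
  have -> : (j < 2 * m - (2 * m - j))%N = false by lia.
  lra.
have [_ /(_ _ _ ij nr)[_ /(_ h)]] := inc 0%N isT.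
by rewrite !avecE /= subn0 !ltn_ord; lra.
Qed.

Lemma rho_closed : closed_alcove rho.
Proof.
have [] // := @barycenter_incident R m hm [set: 'I_m.+1]%SET.
by apply/set0Pn; exists ord0; rewrite inE.
Qed.

Lemma closed_incident_rho x : closed_alcove x -> incident x rho.
Proof.
move=> Cx; split=> // i j ij nr; have [h1 h2] := rho_generic ij nr.
by split=> [/h1|/h2].
Qed.

Lemma facet_rho_sub : facet rho `<=` @base_alcove R m.
Proof.
move=> x [Ax /(same_facetP rho_closed Ax)[[Cx _] [_ h]]].
have strict i j : (i < j)%N -> j != rev_ord i -> -1 < x ord0 i - x ord0 j < 0.
  move=> ij nr; have [n0 n1] := rho_generic ij nr; have [e0 e1] := h _ _ ij nr.
  have := Cx.2 _ _ ij nr => /andP[b1 b2].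
  by rewrite !lt_neqAle b1 b2 !andbT; apply/andP; split; apply/eqP => e;
    [apply: n1; apply: e1|apply: n0; apply: e0].
have nr_of i j : (i + j <> 2 * m - 1)%N -> j != rev_ord i.
  move=> hh; apply/eqP => e; apply: hh; rewrite e /=; have := ltn_ord i; lia.
split=> //.
  move=> i j i0 j1; split.
    by have := strict i j ltac:(lia) (nr_of i j ltac:(lia)); lra.
  have := strict j (rev_ord i) ltac:(rewrite /=; lia) _.
  have nr : rev_ord i != rev_ord j by apply: nr_of; rewrite /=; lia.
  by move/(_ nr); lra.
move=> i j i1 im ij.
by have := strict i j ltac:(lia) (nr_of i j ltac:(lia)); lra.
Qed.

(** Every point of the closed alcove is incident to [rho], so the closed alcove is the closure of
    the facet of [rho]; the base alcove is caught between the two. *)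
Lemma closure_base_alcove x : closure (@base_alcove R m) x <-> closed_alcove x.
Proof.
have E : closure (facet rho) = [set y | closed_alcove y].
  apply/seteqP; split=> y; first by move/(closure_facetP _ rho_closed) => [].
  by move=> /= /closed_incident_rho /(closure_facetP _ rho_closed).
split=> h; last first.
  by apply: (closureS facet_rho_sub); rewrite E.
have cc := (closure_id (closure (facet rho))).1 (@closed_closure _ _).
have : closure (facet rho) x.
  by rewrite cc; apply: (closureS _ h); rewrite E => y; exact: base_alcove_closed.
by rewrite E.
Qed.

(** Holds for any facet F with the prescribed minimal subfacets: F is the facet of v, so the
    vertices incident to v agree with those of I up to translation along (1, ..., 1), which P
    tolerates. *)
Lemma FI_ind I (P : V -> Prop) v : convex_pred P -> translation_inv P ->
  (forall a, FI_vertices I a -> P a) -> FI I v -> P v.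
Proof.
move=> cP tP hP [F [[[x Ax FE] sub] minE Fv]].
have FE' : F = facet x by [].
have Cv : closed_alcove v by apply/closure_base_alcove; exact: sub.
have Fv' : F = facet v.
  by move: Fv; rewrite FE' => -[_ h]; exact: facet_eq.
apply: (closed_alcove_ind hm cP tP Cv) => a va av.
have : [set G | minimal_subfacet G F] (line a).
  by rewrite Fv' (minimal_subfacets hm Cv); exists a.
rewrite minE => -[b hb ab].
have : line b a by rewrite ab; exists 0 => //; apply/rowP => j; rewrite !mxE addr0.
by move=> [t _ <-]; apply: tP; exact: hP.
Qed.

Section Vertices.
Variable I : {set 'I_m.+1}.
Hypotheses (I0 : I != finset.set0) (Ic : index_cond I).

Lemma facet_sub_FI : facet (barycenter R I) `<=` FI I.
Proof.
have [CB _] := barycenter_incident R hm I0.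
move=> x xB; exists (facet (barycenter R I)); split=> //.
  split; first by exists (barycenter R I); [case: CB|].
  move=> y [Ay /(same_facetP CB Ay)[[Cy _] _]]; exact/closure_base_alcove.
by rewrite (minimal_subfacets hm CB) (FI_verticesE R hm I0 Ic).
Qed.

(** The vertices are in general only limits of points of F_I; together with [displ_closure] this
    carries permissibility to them. *)
Lemma FI_vertex_closure a : FI_vertices I a -> closure (FI I) a.
Proof.
have [CB _] := barycenter_incident R hm I0.
rewrite (FI_verticesE R hm I0 Ic) => -[_ aB].
apply: (closureS facet_sub_FI); exact/closure_facetP.
Qed.

End Vertices.

Lemma wactionE (w : affelt m) u j :
  waction w u ord0 j = (w.1 ord0 j)%:~R + u ord0 ((w.2^-1)%g j).
Proof. by rewrite /waction mxE vpermE mxE. Qed.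

Lemma waction_affine (w : affelt m) x y (t : R) :
  waction w (t *: x + (1 - t) *: y) =
  t *: waction w x + (1 - t) *: waction w y.
Proof. by apply/rowP => j; rewrite wactionE 2!mxE; rewrite !mxE; ring. Qed.

Lemma waction_const (w : affelt m) x (t : R) :
  waction w (x + const_mx t) = waction w x + const_mx t.
Proof. by apply/rowP => j; rewrite wactionE !mxE addrA. Qed.

Lemma waction_mul (w w' : affelt m) x :
  waction (wmul w w') x = waction w (waction w' x).
Proof.
by apply/rowP => j; rewrite !wactionE /= mxE vpermE rmorphD addrA invMg permM.
Qed.

(** [WI] is defined by a_1 and a_{m-1} instead of a_0' and a_m'. An affine map fixing a_0 and the
    midpoint a_1 of a_0 and a_0' also fixes a_0'; that a_0 is fixed comes from the condition on I.
    The other end is alike. *)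
Lemma fixes_FI_vertices (w : affelt m) I a : index_cond I ->
  (forall k : 'I_m.+1, k \in I -> waction w (avec k) = avec k) ->
  FI_vertices I a -> waction w a = a.
Proof.
move=> Ic h [k kI].
have fix_end (b c d : V) : d = 2^-1 *: (b + c) -> waction w d = d ->
    waction w b = b -> waction w c = c.
  move=> -> e1 e2; apply/rowP => j.
  have := congr1 (fun z : V => z ord0 j) e1; have := congr1 (fun z : V => z ord0 j) e2.
  by rewrite !wactionE !midE; lra.
case=> [[_ _ ->]|[k1 ->]|[k1 ->]]; first exact: h.
  have h1 := h _ kI; rewrite k1 in h1.
  apply: (fix_end (avec 0) _ _ (avec1_mid R hm) h1).
  by apply: (h ord0); have [/(_ k1)] := Ic _ kI.
have h1 := h _ kI; rewrite k1 in h1.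
apply: (fix_end (avec m) _ _ (avecm1_mid R hm) h1).
by apply: (h ord_max); have [_ /(_ k1)] := Ic _ kI.
Qed.

Lemma WI_fixes_FI (w : affelt m) I J v : index_cond I -> I \subset J ->
  WI R J w -> FI I v -> waction w v = v.
Proof.
move=> Ic /fintype.subsetP IJ [_ h]; apply: (@FI_ind I (fun v : V => waction w v = v)).
- by move=> x y t _ /= hx hy; rewrite waction_affine hx hy.
- by move=> x t hx; rewrite waction_const hx.
- by move=> a; apply: fixes_FI_vertices => // k /IJ; exact: h.
Qed.

End FaceOfIndexSet.

(** * Permissibility and the spin conditions *)

Section SpinConditions.
Variables (R : realType) (m q : nat).
Hypotheses (hm : (2 <= m)%N) (qm : (q < m)%N).
Local Notation V := 'rV[R]_(2 * m).
Local Notation avec := (avec R m).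
Local Notation avec0' := (avec0' R m).
Local Notation avecm' := (avecm' R m).
Local Notation mu := (mu_vec m q).
Implicit Types (a u v x y : V) (i j l : 'I_(2 * m)) (I J : {set 'I_m.+1}).
Implicit Type w : affelt m.

Definition displ w a : V := waction w a - a.

Lemma displE w a j :
  displ w a ord0 j = (w.1 ord0 j)%:~R + a ord0 ((w.2^-1)%g j) - a ord0 j.
Proof. by rewrite /displ [LHS]mxE wactionE [X in _ + X]mxE. Qed.

Lemma displ_halfint w a : (forall j, a ord0 j * 2 \is a Num.int) ->
  halfint (displ w a).
Proof.
by move=> ha j; rewrite displE mulrBl mulrDl rpredB ?rpredD ?ha // rpredM ?int_num2 ?intr_int.
Qed.

Lemma displ_slide w a p (t : R) : commutes_rev w.2 ->
  displ w (a + (- t) *: dvec R p) = slide (displ w a) p (w.2 p) t.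
Proof.
move=> hc; apply/rowP => j; rewrite slideE !displE !addZE -(vperm_dvec R p hc) vpermE.
ring.
Qed.

(** The conditions defining the polytope are closed and [displ w] is continuous. *)
Lemma displ_closure (F : set V) w a : closure F a ->
  (forall v, F v -> polytope q (displ w v)) -> polytope q (displ w a).
Proof.
move=> /closureP ha h.
(* An entry of the displacement involves the point at two indices, hence e / 2. *)
have near (e : R) : 0 < e -> exists2 y, polytope q y &
    forall j, `|displ w a ord0 j - y ord0 j| < e.
  move=> e0; have [|v Fv hv] := ha (e / 2); first lra.
  exists (displ w v); first exact: h.
  move=> j; rewrite !displE.
  by have := hv j; have := hv ((w.2^-1)%g j); rewrite !ltr_norml; lra.
split.
- move=> j; apply/eqP/negPn/negP => hne.
  set D := displ w a ord0 j + displ w a ord0 (rev_ord j) in hne.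
  have D0 : 0 < `|D - 2| by rewrite normr_gt0 subr_eq0.
  have [|y [hy _ _] hj] := near (`|D - 2| / 2); first lra.
  have : `|D - 2| < `|D - 2|.
    rewrite {1}/D; have := hj j; have := hj (rev_ord j); have := hy j.
    by rewrite !ltr_norml; lra.
  by rewrite ltxx.
- move=> j; apply/andP; split; rewrite leNgt; apply/negP => hlt.
    have [|y [_ hy _] hj] := near (- displ w a ord0 j); first lra.
    by have := hj j; have := hy j; rewrite ltr_norml; lra.
  have [|y [_ hy _] hj] := near (displ w a ord0 j - 2); first lra.
  by have := hj j; have := hy j; rewrite ltr_norml; lra.
rewrite leNgt; apply/negP => hlt; set D := dev _ in hlt.
have m0 : 0 < (2 * m)%:R :> R by rewrite ltr0n; lia.
(* The excess of [dev] over 2q is spread evenly over the 2m entries. *)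
have [|y [_ _ hy] hj] := near ((D - (2 * q)%:R) / (2 * m)%:R).
  by rewrite divr_gt0 // subr_gt0.
have : D < dev y + (D - (2 * q)%:R).
  have -> : D - (2 * q)%:R =
      \sum_(j < 2 * m) ((D - (2 * q)%:R) / (2 * m)%:R).
    by rewrite sumr_const card_ord -[RHS]mulr_natr divfK // gt_eqF.
  rewrite {1}/D /dev -big_split /=; apply: ltr_sum => //.
    by apply/hasP; exists (Ordinal (ltac:(lia) : (0 < 2 * m)%N)); rewrite ?mem_index_enum.
  move=> j _; have := hj j; set e := _ / _ => he.
  rewrite (_ : displ w a ord0 j - 1 = (y ord0 j - 1) + (displ w a ord0 j - y ord0 j)); last by ring.
  by apply: le_lt_trans (ler_normD _ _) _; rewrite ltrD2l.
lra.
Qed.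

Lemma QveeD (x y : 'rV[int]_(2 * m)) : Qvee x -> Qvee y -> Qvee (x + y).
Proof.
move=> [_ x2 x3] [_ y2 y3].
have h (i : 'I_(2 * m)) : (x + y) ord0 i + (x + y) ord0 (rev_ord i) = 0.
  by rewrite !mxE addrACA x2 y2 addr0.
split=> //; first by move=> i j; rewrite !h.
rewrite (eq_bigr (fun i => x ord0 i + y ord0 i)) => [|i _]; last by rewrite mxE.
by rewrite big_split /=; exact: rpredD.
Qed.

Lemma avecmE j : avec m ord0 j = if (j < m)%N then - 2^-1 else 2^-1.
Proof.
by rewrite avecE; case: ifP => // h; case: ifP => // h'; exfalso; lia.
Qed.

(* This is where the evenness of the permutations in [Scirc] matters: by
   [odd_perm_rev] an even number of indices cross the middle. *)
Lemma displ_avecm w : Qvee (w.1 - mu) -> Scirc w.2 ->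
  congr_Qvee (displ w (avec m)) mu.
Proof.
move=> hQ [odd_s hc]; pose s := (w.2^-1)%g.
have hcs : commutes_rev s by exact: commutes_revV.
(* The displacement of a_m under the linear part alone; over the lower half its entries add up to
   the number of indices that s sends to the upper half. *)
pose x : 'rV[int]_(2 * m) := \row_j ((j < m)%N%:R - (s j < m)%N%:R).
have hx i : x ord0 i + x ord0 (rev_ord i) = 0.
  rewrite !mxE hcs !low_rev.
  by case: (i < m)%N; case: (s i < m)%N.
exists ((w.1 - mu) + x).
  apply: QveeD => //; split=> //; first by move=> i j; rewrite !hx.
  rewrite (eq_bigr (fun i : 'I_(2 * m) => (~~ (s i < m)%N)%:R)) => [|i hi]; last first.
    by rewrite mxE hi; case: (s i < m)%N.
  have -> : \sum_(i < 2 * m | (i < m)%N) (~~ (s i < m)%N)%:R = (nflips s)%:Z.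
    rewrite /nflips -natz natr_sum big_mkcond; apply: eq_bigr => i _.
    by case: (i < m)%N.
  rewrite dvdzE /= dvdn2 -odd_perm_rev //.
  by rewrite odd_permV.
apply/rowP => j; rewrite [LHS]mxE displE !avecmE !mxE !rmorphD !rmorphN /=.
by rewrite -/s; case: (j < m)%N; case: (s j < m)%N => /=; lra.
Qed.

Lemma displ_avec0 w : displ w (avec 0) = toR R w.1.
Proof.
apply/rowP => j; rewrite displE !avecE /= subn0 !ltn_ord.
by rewrite mxE; ring.
Qed.

Lemma displ_avec0_congr w : Qvee (w.1 - mu) -> congr_Qvee (displ w (avec 0)) mu.
Proof.
move=> hQ; exists (w.1 - mu) => //; rewrite displ_avec0.
by apply/rowP => j; rewrite !mxE rmorphB.
Qed.

Lemma displ_avec0_int w : integral_vec (displ w (avec 0)).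
Proof. by move=> j; rewrite displ_avec0 mxE intr_int. Qed.

Lemma displ_avecm_int w : integral_vec (displ w (avec m)).
Proof.
move=> j; rewrite displE -addrA rpredD ?intr_int //.
by apply: half_pm_sub; exact: avecm_half.
Qed.

Lemma displ_mid w x y : displ w (2^-1 *: (x + y)) = 2^-1 *: (displ w x + displ w y).
Proof. by apply/rowP => j; rewrite displE !midE !displE; lra. Qed.

Let p0P : (0 < 2 * m)%N. Proof. by lia. Qed.
Let pmP : (m < 2 * m)%N. Proof. by lia. Qed.
(** In 1-based indices these are 1 and m + 1 (not m): then a_1, a_0' arise from a_0, and a_{m-1},
    a_m' from a_m, by the same shifts -t (e_p - e_{p^*}), with t = 1/2 and t = 1. *)
Let p0 : 'I_(2 * m) := Ordinal p0P.
Let pm : 'I_(2 * m) := Ordinal pmP.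

Lemma eq_p0 j : (j == p0) = (j == 0%N :> nat). Proof. by []. Qed.
Lemma eq_rp0 j : (j == rev_ord p0) = (j == (2 * m - 1)%N :> nat).
Proof. by []. Qed.
Lemma eq_pm j : (j == pm) = (j == m :> nat). Proof. by []. Qed.
Lemma eq_rpm j : (j == rev_ord pm) = (j == (m - 1)%N :> nat).
Proof.
rewrite -[LHS]/((j : nat) == (2 * m - m.+1)%N).
by have -> : (2 * m - m.+1 = m - 1)%N by lia.
Qed.

Lemma avec1E : avec 1 = avec 0 + (- 2^-1) *: dvec R p0.
Proof.
apply/rowP => j; rewrite addZE dvecE eq_p0 eq_rp0 !avecE.
have := ltn_ord j => jm.
case: (ltnP j 1) => h1; case: (ltnP j (2 * m - 1)) => h2;
case: (ltnP j 0) => h3; case: (ltnP j (2 * m - 0)) => h4;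
case: (eqVneq (j : nat) 0%N) => h5; case: (eqVneq (j : nat) (2 * m - 1)%N) => h6;
  try (exfalso; lia); rewrite /=; lra.
Qed.

Lemma avec0'_E : avec0' = avec 0 + (- 1) *: dvec R p0.
Proof.
apply/rowP => j; rewrite addZE dvecE eq_p0 eq_rp0 avecE avec0'E.
rewrite /= subn0 ltn_ord.
case: (eqVneq (j : nat) 0%N) => h5; case: (eqVneq (j : nat) (2 * m - 1)%N) => h6;
  try (exfalso; lia); rewrite /=; lra.
Qed.

Lemma avecm1E : avec (m - 1) = avec m + (- 2^-1) *: dvec R pm.
Proof.
apply/rowP => j; rewrite addZE dvecE eq_pm eq_rpm avecmE avecE.
have := ltn_ord j => jm.
case: (ltnP j (m - 1)) => h1; case: (ltnP j (2 * m - (m - 1))) => h2;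
case: (ltnP j m) => h3;
case: (eqVneq (j : nat) m) => h5; case: (eqVneq (j : nat) (m - 1)%N) => h6;
  try (exfalso; lia); rewrite /=; lra.
Qed.

Lemma avecm'_E : avecm' = avec m + (- 1) *: dvec R pm.
Proof.
apply/rowP => j; rewrite addZE dvecE eq_pm eq_rpm avecmE avecm'E.
have := ltn_ord j => jm.
case: (ltnP j (m - 1)) => h1; case: (ltnP j m) => h3;
case: (eqVneq (j : nat) m) => h5; case: (eqVneq (j : nat) (m - 1)%N) => h6;
  try (exfalso; lia); rewrite /=; lra.
Qed.

Section Element.
Variables (w : affelt m) (I : {set 'I_m.+1}).
Hypotheses (I0 : I != finset.set0) (Ic : index_cond I).
Hypotheses (wQ : Qvee (w.1 - mu)) (wS : Scirc w.2).

Let wc : commutes_rev w.2 := proj2 wS.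

Lemma nuP (k : nat) : (SP1' (nu R k w) /\ SP2' q (nu R k w)) <->
  polytope q (displ w (avec k)).
Proof. by apply: SP12P; apply: displ_halfint; exact: avec_half. Qed.

Lemma displ1 : displ w (avec 1) = slide (displ w (avec 0)) p0 (w.2 p0) 2^-1.
Proof. by rewrite avec1E displ_slide. Qed.

Lemma displ0' : displ w avec0' = slide (displ w (avec 0)) p0 (w.2 p0) 1.
Proof. by rewrite avec0'_E displ_slide. Qed.

Lemma displm1 :
  displ w (avec (m - 1)) = slide (displ w (avec m)) pm (w.2 pm) 2^-1.
Proof. by rewrite avecm1E displ_slide. Qed.

Lemma displm' : displ w avecm' = slide (displ w (avec m)) pm (w.2 pm) 1.
Proof. by rewrite avecm'_E displ_slide. Qed.

Lemma spin_of_permissible :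
  (forall v, FI I v -> conv_orbit mu (displ w v)) -> spin_conditions R q I w.
Proof.
move=> h.
have hv a : FI_vertices I a -> polytope q (displ w a).
  move=> /(FI_vertex_closure hm I0 Ic) ha; apply: displ_closure ha _ => v /h.
  exact/conv_orbit_polytope/ltnW.
have hend (k : 'I_m.+1) : k \in I -> k <> 1%N :> nat -> k <> (m - 1)%N :> nat ->
    polytope q (displ w (avec k)).
  by move=> kI k1 k2; apply: hv; exists k => //; apply: Or31.
have h1 (k : 'I_m.+1) : k \in I -> k = 1%N :> nat ->
    polytope q (displ w (avec 0)) /\ polytope q (displ w avec0').
  move=> kI k1; split; last by apply: hv; exists k => //; apply: Or32.
  by have [/(_ k1) oI _] := Ic kI; apply: (hend ord0 oI); rewrite /=; lia.
have hm1 (k : 'I_m.+1) : k \in I -> k = (m - 1)%N :> nat ->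
    polytope q (displ w (avec m)) /\ polytope q (displ w avecm').
  move=> kI k1; split; last by apply: hv; exists k => //; apply: Or33.
  by have [_ /(_ k1) oI] := Ic kI; apply: (hend ord_max oI); rewrite /=; lia.
split.
  move=> k kI; apply/nuP.
  have [k1|/eqP k1] := eqVneq (k : nat) 1%N.
    rewrite k1 (avec1_mid R hm) displ_mid; have [? ?] := h1 k kI k1.
    by apply: (convex_mid (@polytope_convex R m q)).
  have [k2|/eqP k2] := eqVneq (k : nat) (m - 1)%N; last exact: hend.
  rewrite k2 (avecm1_mid R hm) displ_mid; have [? ?] := hm1 k kI k2.
  by apply: (convex_mid (@polytope_convex R m q)).
move=> k kI; rewrite !inE => hk.
have [k0|k0] := eqVneq (k : nat) 0%N.
  by rewrite k0 => _ []; exact: displ_avec0_congr.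
have [km|km] := eqVneq (k : nat) m.
  by rewrite km => _ []; exact: displ_avecm.
have [k1|k1] := eqVneq (k : nat) 1%N.
  have [P0 P1] := h1 k kI k1.
  rewrite k1 /SP3' -[nu R 1 w]/(displ w (avec 1)) displ1 => hi hn.
  rewrite displ0' in P1.
  have [e1 e2 [j [jp jrp ej]]] := slide_ones qm (displ_avec0_int w)
    (displ_avec0_congr wQ) P0 P1 hi hn.
  exists p0, j; split=> //; first by rewrite inE.
  move: jp jrp; rewrite eq_p0 eq_rp0 inE; have := ltn_ord j; lia.
have k2 : (k : nat) = (m - 1)%N.
  by move: hk; rewrite (negPf k0) (negPf k1) (negPf km) !orbF /= => /eqP.
have [P0 P1] := hm1 k kI k2.
rewrite k2 /SP3' -[nu R (m - 1) w]/(displ w (avec (m - 1))) displm1 => hi hn.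
rewrite displm' in P1.
have [e1 e2 [j [jp jrp ej]]] := slide_ones qm (displ_avecm_int w)
  (displ_avecm wQ wS) P0 P1 hi hn.
(* The roles are reversed at this end: the pair m, m + 1 is B_{m-1} and supplies the second index,
   while j lies in A_{m-1}. *)
exists j, pm; split=> //; last by rewrite inE /=; lia.
move: jp jrp; rewrite eq_pm eq_rpm inE; have := ltn_ord j; lia.
Qed.

Lemma permissible_of_spin : spin_conditions R q I w ->
  forall v, FI I v -> conv_orbit mu (displ w v).
Proof.
move=> [h12 h3] v.
apply: (@FI_ind R m hm I (fun v : V => conv_orbit mu (displ w v))).
- move=> x y t t01 hx hy /=.
  have -> : displ w (t *: x + (1 - t) *: y) = t *: displ w x + (1 - t) *: displ w y.
    by rewrite /displ waction_affine; apply/rowP => j; rewrite !mxE; ring.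
  exact: conv_orbit_convex.
- move=> x t /= hx; rewrite (_ : displ w (x + const_mx t) = displ w x) //.
  by rewrite /displ waction_const; apply/rowP => j; rewrite !mxE; ring.
have P k : k \in I -> polytope q (displ w (avec k)) by move=> kI; exact/nuP/h12.
move=> a [k kI]; case=> [[k1 k2 ->]|[k1 ->]|[k1 ->]].
- apply: (polytope_conv_orbit qm); last exact: P.
  by apply: displ_halfint; exact: avec_half.
- apply: (polytope_conv_orbit qm).
    by apply: displ_halfint => j; rewrite rpredM ?int_num2 // avec0'_int.
  have P1 := P k kI; have [/(_ k1) oI _] := Ic kI; have P0 := P ord0 oI.
  rewrite k1 displ1 in P1.
  rewrite displ0'; apply: (polytope_slide qm (displ_avec0_int w)
    (displ_avec0_congr wQ) P0 P1) => hi hn.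
  have k_in : (k : nat) \in [:: 0; 1; m - 1; m]%N by rewrite k1.
  have := h3 k kI k_in; rewrite k1 /SP3' -[nu R 1 w]/(displ w (avec 1)) displ1.
  (* A_1 consists of [p0] and its conjugate, so this index is in the pair that [polytope_slide] asks
     for. *)
  case=> // j1 [_ [hj1 _ e _]]; exists j1 => //.
  by move: hj1; rewrite inE eq_p0 eq_rp0; have := ltn_ord j1; lia.
apply: (polytope_conv_orbit qm).
  apply: displ_halfint => j; case: (@avecm'_half R m j) => ->;
    by rewrite ?mulNr ?rpredN mulVf ?int_num1 // pnatr_eq0.
have P1 := P k kI; have [_ /(_ k1) oI] := Ic kI; have P0 := P ord_max oI.
rewrite k1 displm1 in P1.
rewrite displm'; apply: (polytope_slide qm (displ_avecm_int w)
  (displ_avecm wQ wS) P0 P1) => hi hn.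
have k_in : (k : nat) \in [:: 0; 1; m - 1; m]%N by rewrite k1 !inE eqxx !orbT.
have := h3 k kI k_in; rewrite k1 /SP3' -[nu R (m - 1) w]/(displ w (avec (m - 1))) displm1.
case=> // _ [j2 [_ hj2 _ e]]; exists j2 => //.
by move: hj2; rewrite inE eq_pm eq_rpm; have := ltn_ord j2; lia.
Qed.

End Element.

Lemma Waff_coset_mu w : Waff_coset (wtrans mu) w -> Qvee (w.1 - mu) /\ Scirc w.2.
Proof.
move=> [[l s] [/= hl hs] <-] /=; rewrite mulg1; split=> //.
suff -> : mu + vperm 1 l - mu = l by [].
by apply/rowP => j; rewrite addrC addKr vpermE invg1 perm1.
Qed.

Lemma WI_id I : WI R I (wtrans 0).
Proof.
split; first split.
- split.
  + by move=> i j; rewrite !mxE.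
  + by move=> i; rewrite !mxE.
  + by rewrite big1 // => i _; rewrite mxE.
- by split; [rewrite odd_perm1|move=> i; rewrite !perm1].
move=> k _; apply/rowP => j; rewrite wactionE mxE.
by rewrite add0r invg1 perm1.
Qed.

(** Both x and y fix v, the former because I is contained in J. So the displacement of v under x w0
    y is that under w0, moved by the linear part of x, and the hull is stable under the Weyl
    group. *)
Lemma double_coset_displ I J w0 w v : I \subset J -> index_cond I ->
  double_coset (WI R J) (WI R I) w0 w -> FI I v ->
  conv_orbit mu (displ w v) <-> conv_orbit mu (displ w0 v).
Proof.
move=> IJ Ic [x hx [y hy <-]] hv.
have xv := WI_fixes_FI hm Ic IJ hx hv.
have yv := WI_fixes_FI hm Ic (fintype.subxx _) hy hv.
have -> : displ (wmul (wmul x w0) y) v = vperm x.2 (displ w0 v).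
  rewrite /displ !waction_mul yv -{2}xv.
  by apply/rowP => j; rewrite vpermE [LHS]mxE !wactionE !mxE; ring.
have [[_ xS] _] := hx.
by split; [exact: conv_orbit_vpermV|exact: conv_orbit_vperm].
Qed.

End SpinConditions.

Theorem proposition8p16p1 (R : realType) (m q : nat)
    (hm : (2 <= m)%N) (hq : (0 <= q <= m - 1)%N)
    (I J : {set 'I_m.+1}) (hI0 : I != finset.set0) (hJ0 : J != finset.set0)
    (hIJ : I \subset J) (hI : index_cond I) (hJ : index_cond J)
    (w : set (affelt m)) (hw : is_double_coset (WI R J) (WI R I) w) :
  (permissible R (mu_vec m q) I w <->
     dcoset_congr (mu_vec m q) w /\
     exists2 w' : affelt m, w w' & spin_conditions R q I w') /\
  (permissible R (mu_vec m q) I w <->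
     dcoset_congr (mu_vec m q) w /\
     forall w' : affelt m, w w' -> spin_conditions R q I w').
Proof.
have qm : (q < m)%N by lia.
have [w0 _ wE] := hw.
(* A condition on all representatives gives one on some representative because the double coset is
   nonempty. *)
have [w1 Dw1] : exists w1, w w1.
  exists (wmul (wmul (wtrans 0) w0) (wtrans 0)); rewrite wE.
  exists (wtrans 0); first exact: WI_id.
  by exists (wtrans 0); first exact: WI_id.
have spin_all : permissible R (mu_vec m q) I w ->
    forall w', w w' -> spin_conditions R q I w'.
  move=> [hc [w2 Dw2 h2]] w' Dw'; have [wQ wS] := Waff_coset_mu (hc _ Dw').
  apply: spin_of_permissible => // v hv; rewrite wE in Dw' Dw2.
  apply/(double_coset_displ q hm hIJ hI Dw' hv).
  by apply/(double_coset_displ q hm hIJ hI Dw2 hv); exact: h2.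
have perm_one w' : dcoset_congr (mu_vec m q) w -> w w' ->
    spin_conditions R q I w' -> permissible R (mu_vec m q) I w.
  move=> hc Dw' hs; split=> //; exists w' => // v hv.
  have [wQ wS] := Waff_coset_mu (hc _ Dw').
  exact: (permissible_of_spin hm qm hI0 hI wQ wS hs).
split; split=> [hp|[hc]].
- by split; [case: hp|exists w1 => //; exact: spin_all].
- by move=> [w' Dw' hs]; exact: perm_one Dw' hs.
- by split; [case: hp|exact: spin_all].
- by move=> h; exact: (perm_one w1 hc Dw1 (h _ Dw1)).
Qed.
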